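(* Let $H$ be a Hopf algebra with invertible antipode over a field $k$ of characteristic $0$. The category of (left-right) anti-Yetter-Drinfeld modules over $H$ is equivalent to the center $\mathcal{Z}_{\mathcal{M}^H}(\mathcal{M}^{H\,op})$ of the opposite bimodule category $\mathcal{M}^{H\,op}$ over the monoidal category $\mathcal{M}^H$ of right $H$-comodules.
   Context: Sweedler notation: $\Delta(h)=h^1\otimes h^2$, $(\Delta\otimes 1)\Delta(h)=h^1\otimes h^2\otimes h^3$; a right coaction is $m\mapsto m_0\otimes m_1$. $S$ is the antipode. $\mathcal{M}^H$ is monoidal with coaction $m_0\otimes n_0\otimes m_1n_1$ on $M\otimes N$; $\mathrm{Hom}$ denotes $k$-linear maps, $\mathrm{Hom}(-,-)^H$ comodule maps. Anti-Yetter-Drinfeld ($aYD$) module: a left $H$-module and right $H$-comodule $M$ with $(hm)_0\otimes(hm)_1=h^2m_0\otimes h^3m_1S(h^1)$ for all $h\in H$, $m\in M$. Morphisms are maps that are both $H$-linear and $H$-colinear. Internal Homs: for $W,V\in\mathcal{M}^H$ and $f\in\mathrm{Hom}(W,V)$ put $\rho^lf(w)=f(w_0)_0\otimes f(w_0)_1S(w_1)$ and $\rho^rf(w)=f(w_0)_0\otimes S^{-1}(w_1)f(w_0)_1$, elements of $\mathrm{Hom}(W,V\otimes H)$. $\mathrm{Hom}^l(W,V)$ (resp. $\mathrm{Hom}^r(W,V)$) is the subspace of $f$ with $\rho^lf$ (resp. $\rho^rf$) in $\mathrm{Hom}(W,V)\otimes H$; these are $H$-comodules with coactions $\rho^l$,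 $\rho^r$, and $\mathrm{Hom}(T\otimes W,V)^H\simeq\mathrm{Hom}(T,\mathrm{Hom}^l(W,V))^H$, $\mathrm{Hom}(W\otimes T,V)^H\simeq\mathrm{Hom}(T,\mathrm{Hom}^r(W,V))^H$. Opposite bimodule category $\mathcal{M}^{H\,op}$: it has left action $W\triangleright V=\mathrm{Hom}^l(W,V)$ and right action $V\triangleleft W=\mathrm{Hom}^r(W,V)$ of $\mathcal{M}^H$, with the associativity identifications $(W\otimes V)\triangleright M\simeq W\triangleright(V\triangleright M)$, $(M\triangleleft W)\triangleleft V\simeq M\triangleleft (W\otimes V)$, $W\triangleright(M\triangleleft V)\simeq (W\triangleright M)\triangleleft V$ induced by the adjunctions (currying). Center: an object of $\mathcal{Z}_{\mathcal{M}^H}(\mathcal{M}^{H\,op})$ is a comodule $M$ together with isomorphisms $\tau_W:W\triangleright M\to M\triangleleft W$ in $\mathcal{M}^H$, natural in $W\in\mathcal{M}^H$, such that $\tau_k$ is the identity of $M$ (under $k\triangleright M= M= M\triangleleft k$) and such that, under the associativity identifications, $\tau_{W\otimes V}$ equals the composite $W\triangleright(V\triangleright M)\xrightarrow{Id\triangleright\tau_V}W\triangleright(M\triangleleft V)\simeq(W\triangleright M)\triangleleft V\xrightarrow{\tau_W\triangleleft Id}(M\triangleleft W)\triangleleft V$. Morphisms $(M,\tau)\to(M',\tau')$ are comodule maps $\theta:M\to M'$ with $(\theta\circ-)\circ\tau_W=\tau'_W\circ(\theta\circ -)$ for all $W$. *)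

(* Defs.v *)
From HB Require Import structures.
From mathcomp Require Import all_boot all_order all_algebra.
From mathcomp Require Import boolp classical_sets functions.

Set Implicit Arguments.
Unset Strict Implicit.
Unset Printing Implicit Defensive.

Import GRing.Theory.
Local Open Scope ring_scope.
Local Open Scope quotient_scope.

Section Tensor.
Variables (k : fieldType) (V W : lmodType k).

(* Formal sums of pure tensors are lists of pairs; [teq] is the congruence      *)
(* generated by commutativity and bilinearity, so [tens] is the usual quotient  *)
(* of the free commutative monoid on V x W.                                     *)
Inductive teq : seq (V * W) -> seq (V * W) -> Prop :=
| teq_refl s : teq s s
| teq_sym s t : teq s t -> teq t s
| teq_trans s t u : teq s t -> teq t u -> teq s u
| teq_cat s s' t t' : teq s s' -> teq t t' -> teq (s ++ t) (s' ++ t')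
| teq_catC s t : teq (s ++ t) (t ++ s)
| teq_Dl v v' w : teq [:: (v + v', w)] [:: (v, w); (v', w)]
| teq_Dr v w w' : teq [:: (v, w + w')] [:: (v, w); (v, w')]
| teq_Z a v w : teq [:: (a *: v, w)] [:: (v, a *: w)]
| teq_0 w : teq [:: (0, w)] [::].

Definition teqb (s t : seq (V * W)) : bool := `[< teq s t >].

Lemma teqb_equiv : equiv_class_of teqb.
Proof.
split=> [s|s t|t s u].
- exact/asboolP/teq_refl.
- by apply/asboolP/asboolP; apply: teq_sym.
- by move=> /asboolP h1 /asboolP h2; apply/asboolP; apply: teq_trans h2.
Qed.

Canonical teqb_equivRel := EquivRelPack teqb_equiv.

Definition tens : Type := {eq_quot teqb}.
HB.instance Definition _ := Choice.on tens.
HB.instance Definition _ := EqQuotient.on tens.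

Lemma teq_pi s t : teq s t -> \pi_tens s = \pi_tens t.
Proof. by move=> h; apply/eqmodP/asboolP. Qed.

Lemma pi_teq s t : \pi_tens s = \pi_tens t -> teq s t.
Proof. by move/eqmodP/asboolP. Qed.

Lemma teq_repr s : teq (repr (\pi_tens s)) s.
Proof. by apply: pi_teq; rewrite reprK. Qed.

Definition szs (a : k) (s : seq (V * W)) := [seq (a *: p.1, p.2) | p <- s].

Lemma teq_szs a s t : teq s t -> teq (szs a s) (szs a t).
Proof.
rewrite /szs; elim=> /=.
- by move=> ?; apply: teq_refl.
- by move=> ? ? _; apply: teq_sym.
- by move=> ? ? ? _ h1 _; apply: teq_trans.
- by move=> ? ? ? ? _ h1 _ h2; rewrite !map_cat; apply: teq_cat.
- by move=> ? ?; rewrite !map_cat; apply: teq_catC.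
- by move=> ? ? ?; rewrite scalerDr; apply: teq_Dl.
- by move=> ? ? ?; apply: teq_Dr.
- move=> b v w; rewrite scalerA mulrC -scalerA; exact: teq_Z.
- by move=> w; rewrite scaler0; apply: teq_0.
Qed.

Definition tadd (x y : tens) : tens := \pi_tens (repr x ++ repr y).
Definition tzero : tens := \pi_tens [::].
Definition tscale (a : k) (x : tens) : tens := \pi_tens (szs a (repr x)).
Definition topp := tscale (-1).

Lemma tadd_pi s t : tadd (\pi_tens s) (\pi_tens t) = \pi_tens (s ++ t).
Proof. by apply/teq_pi/teq_cat; apply: teq_repr. Qed.

Lemma tscale_pi a s : tscale a (\pi_tens s) = \pi_tens (szs a s).
Proof. by apply/teq_pi/teq_szs/teq_repr. Qed.

Lemma tens_surj (x : tens) : exists s, x = \pi_tens s.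
Proof. by exists (repr x); rewrite reprK. Qed.

Lemma taddA : associative tadd.
Proof.
move=> x y z; have [s ->] := tens_surj x; have [t ->] := tens_surj y.
by have [u ->] := tens_surj z; rewrite !tadd_pi catA.
Qed.
Lemma taddC : commutative tadd.
Proof.
move=> x y; have [s ->] := tens_surj x; have [t ->] := tens_surj y.
by rewrite !tadd_pi; apply/teq_pi/teq_catC.
Qed.
Lemma tadd0 : left_id tzero tadd.
Proof. by move=> x; have [s ->] := tens_surj x; rewrite tadd_pi. Qed.

Lemma tscaleDl' x a b : tscale (a + b) x = tadd (tscale a x) (tscale b x).
Proof.
have [s ->] := tens_surj x; rewrite !tscale_pi tadd_pi; apply: teq_pi.
elim: s => [|[v w] s IHs] /=; first exact: teq_refl.
rewrite scalerDl.
apply: (teq_trans (teq_cat (s := [:: _]) (teq_Dl _ _ _) IHs)).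
set A := szs a s; set B := szs b s.
have -> : [:: (a *: v, w); (b *: v, w)] ++ A ++ B
        = [:: (a *: v, w)] ++ ([:: (b *: v, w)] ++ A) ++ B by [].
have -> : (a *: v, w) :: A ++ (b *: v, w) :: B
        = [:: (a *: v, w)] ++ (A ++ [:: (b *: v, w)]) ++ B by rewrite -!catA.
apply: teq_cat (teq_refl _) (teq_cat _ (teq_refl _)); exact: teq_catC.
Qed.

Lemma tscale0' x : tscale 0 x = tzero.
Proof.
have [s ->] := tens_surj x; rewrite tscale_pi; apply: teq_pi.
elim: s => [|[v w] s IHs] /=; first exact: teq_refl.
rewrite scale0r; exact: (teq_cat (s := [:: _]) (s' := [::]) (teq_0 _) IHs).
Qed.

Lemma tscale1' : left_id 1 tscale.
Proof.
move=> x; have [s ->] := tens_surj x; rewrite tscale_pi; congr (\pi_tens _).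
by rewrite /szs -[RHS]map_id; apply: eq_map => -[v w] /=; rewrite scale1r.
Qed.

Lemma taddN : left_inverse tzero topp tadd.
Proof.
by move=> x; rewrite -[X in tadd _ X]tscale1' -tscaleDl' addNr tscale0'.
Qed.

HB.instance Definition _ :=
  GRing.isZmodule.Build tens taddA taddC tadd0 taddN.

Lemma tscaleA' a b x : tscale a (tscale b x) = tscale (a * b) x.
Proof.
have [s ->] := tens_surj x; rewrite !tscale_pi /szs -map_comp.
by congr (\pi_tens _); apply: eq_map => p /=; rewrite scalerA.
Qed.
Lemma tscaleDr' : right_distributive tscale +%R.
Proof.
move=> a x y; have [s ->] := tens_surj x; have [t ->] := tens_surj y.
by rewrite /GRing.add /= tadd_pi !tscale_pi tadd_pi /szs map_cat.
Qed.

HB.instance Definition _ :=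
  GRing.Zmodule_isLmodule.Build k tens tscaleA' tscale1' tscaleDr' tscaleDl'.

Lemma pi_add s t : \pi_tens s + \pi_tens t = \pi_tens (s ++ t).
Proof. exact: tadd_pi. Qed.
Lemma pi_scale a s : a *: \pi_tens s = \pi_tens (szs a s).
Proof. exact: tscale_pi. Qed.

Definition tpure (v : V) (w : W) : tens := \pi_tens [:: (v, w)].

(* [tlift B t] is the sum of the B v w over a representative of t; it is        *)
(* independent of the representative as soon as B is bilinear ([tlift_pi]).    *)
Definition tlift (U : lmodType k) (B : V -> W -> U) (t : tens) : U :=
  \sum_(p <- repr t) B p.1 p.2.

End Tensor.

Arguments tlift {k V W U} B t.
Arguments tpure {k V W} v w.
Notation "x ⊗ y" := (tpure x y) (at level 39, left associativity).
Notation "V ⨂ W" := (tens V W) (at level 39, left associativity).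
(* Sweedler notation *)
Notation "'\sw_' ( a , b <- t ) E" := (tlift (fun a b => E) t)
  (at level 41, a name, b name, t at level 200, E at level 41,
   format "'[' \sw_ ( a ,  b  <-  t ) '/  '  E ']'").

Section Multilinear.
Variable k : fieldType.
Implicit Types U V W : lmodType k.

Definition lin V U (f : V -> U) := forall a x y, f (a *: x + y) = a *: f x + f y.
Definition bilin V W U (B : V -> W -> U) :=
  (forall w, lin (B^~ w)) /\ (forall v, lin (B v)).

Lemma lin_add V U (f : V -> U) x y : lin f -> f (x + y) = f x + f y.
Proof. by move=> lf; have := lf 1 x y; rewrite !scale1r. Qed.
Lemma lin_0 V U (f : V -> U) : lin f -> f 0 = 0.
Proof. by move=> lf; apply: (addrI (f 0)); rewrite addr0 -lin_add ?addr0. Qed.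
Lemma lin_scale V U (f : V -> U) a x : lin f -> f (a *: x) = a *: f x.
Proof. by move=> lf; have := lf a x 0; rewrite (lin_0 lf) !addr0. Qed.
Lemma lin_opp V U (f : V -> U) x : lin f -> f (- x) = - f x.
Proof. by move=> lf; rewrite -scaleN1r lin_scale // scaleN1r. Qed.
Lemma lin_suml V U (f : V -> U) I (s : seq I) (F : I -> V) :
  lin f -> f (\sum_(i <- s) F i) = \sum_(i <- s) f (F i).
Proof.
move=> lf; elim: s => [|i s IHs]; first by rewrite !big_nil lin_0.
by rewrite !big_cons lin_add // IHs.
Qed.
Lemma linE V U (f : {linear V -> U}) : lin f.
Proof. by move=> a x y; rewrite linearP. Qed.

Lemma tlift_pi V W U (B : V -> W -> U) s : bilin B ->
  tlift B (\pi_(tens V W) s) = \sum_(p <- s) B p.1 p.2.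
Proof.
move=> [Bl Br]; rewrite /tlift.
suff h u v : teq u v -> \sum_(p <- u) B p.1 p.2 = \sum_(p <- v) B p.1 p.2.
  by apply: h; apply: teq_repr.
elim=> //= {u v s}.
- by move=> ? ? ? _ -> _ ->.
- by move=> ? ? ? ? _ h1 _ h2; rewrite !big_cat h1 h2.
- by move=> ? ?; rewrite !big_cat /= addrC.
- by move=> v v' w; rewrite !big_cons !big_nil !addr0 (lin_add _ _ (Bl w)).
- by move=> v w w'; rewrite !big_cons !big_nil !addr0 (lin_add _ _ (Br v)).
- move=> a v w; rewrite !big_cons !big_nil !addr0 (lin_scale _ _ (Bl w)).
  by rewrite (lin_scale _ _ (Br v)).
- by move=> w; rewrite big_cons !big_nil addr0 (lin_0 (Bl w)).
Qed.

Lemma tlift_lin V W U (B : V -> W -> U) : bilin B -> lin (tlift B).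
Proof.
move=> bB a x y; have [s ->] := tens_surj x; have [t ->] := tens_surj y.
rewrite pi_scale pi_add !tlift_pi // big_cat /=.
rewrite /szs big_map scaler_sumr; congr (_ + _).
by apply: eq_bigr => p _ /=; rewrite (lin_scale _ _ (bB.1 _)).
Qed.

Lemma tlift_pure V W U (B : V -> W -> U) v w : bilin B -> tlift B (v ⊗ w) = B v w.
Proof. by move=> bB; rewrite tlift_pi // big_seq1. Qed.

Lemma tpureDl V W (v v' : V) (w : W) : (v + v') ⊗ w = v ⊗ w + v' ⊗ w.
Proof. by rewrite pi_add; apply/teq_pi/teq_Dl. Qed.
Lemma tpureDr V W (v : V) (w w' : W) : v ⊗ (w + w') = v ⊗ w + v ⊗ w'.
Proof. by rewrite pi_add; apply/teq_pi/teq_Dr. Qed.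
Lemma tpureZl V W a (v : V) (w : W) : (a *: v) ⊗ w = a *: (v ⊗ w).
Proof. by rewrite pi_scale. Qed.
Lemma tpureZr V W a (v : V) (w : W) : v ⊗ (a *: w) = a *: (v ⊗ w).
Proof. by rewrite -tpureZl; apply/esym/teq_pi/teq_Z. Qed.

Lemma tpure_bilin V W : bilin (@tpure k V W).
Proof.
by split=> w a x y; rewrite (tpureDl, tpureDr) (tpureZl, tpureZr).
Qed.

Lemma tens_pi V W (s : seq (V * W)) : \pi_(tens V W) s = \sum_(p <- s) p.1 ⊗ p.2.
Proof.
elim: s => [|[v w] s IHs]; first by rewrite big_nil.
by rewrite big_cons -IHs pi_add.
Qed.

Lemma sw_id V W (t : tens V W) : \sw_(a, b <- t) (a ⊗ b) = t.
Proof. by rewrite /tlift -tens_pi reprK. Qed.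

(* [eq_sw] and [sw_swap] hold for arbitrary integrands *)
Lemma eq_sw V W U (B B' : V -> W -> U) t :
  (forall a b, B a b = B' a b) -> tlift B t = tlift B' t.
Proof. by move=> e; apply: eq_bigr => p _; rewrite e. Qed.

Lemma sw_swap V W V' W' U (B : V -> W -> V' -> W' -> U) t t' :
  \sw_(a, b <- t) \sw_(c, d <- t') B a b c d
  = \sw_(c, d <- t') \sw_(a, b <- t) B a b c d.
Proof. by rewrite /tlift exchange_big. Qed.

Lemma lin_sw V W U U' (f : U -> U') (B : V -> W -> U) t : lin f ->
  f (tlift B t) = \sw_(a, b <- t) f (B a b).
Proof. by move=> lf; rewrite /tlift lin_suml. Qed.

Lemma sw_sw V W V' W' U (B : V -> W -> U) (C : V' -> W' -> tens V W) t :
  bilin B -> \sw_(a, b <- \sw_(c, d <- t) C c d) B a b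
  = \sw_(c, d <- t) \sw_(a, b <- C c d) B a b.
Proof. by move=> bB; rewrite lin_sw //; apply: tlift_lin. Qed.

Lemma lin_id V : lin (fun x : V => x). Proof. by []. Qed.
Lemma lin_cst0 V U : lin (fun _ : V => 0 : U).
Proof. by move=> *; rewrite scaler0 addr0. Qed.
Lemma lin_comp V W U (f : {linear W -> U}) (g : V -> W) :
  lin g -> lin (fun x => f (g x)).
Proof. by move=> lg a x y; rewrite lg linearP. Qed.
Lemma lin_comph V W U (f : W -> U) (g : V -> W) :
  lin f -> lin g -> lin (fun x => f (g x)).
Proof. by move=> lf lg a x y; rewrite lg lf. Qed.
Lemma lin_pureL V W U (g : V -> W) (c : U) : lin g -> lin (fun x => g x ⊗ c).
Proof. by move=> lg a x y; rewrite lg (tpure_bilin _ _).1. Qed.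
Lemma lin_pureR V W U (c : U) (g : V -> W) : lin g -> lin (fun x => c ⊗ g x).
Proof. by move=> lg a x y; rewrite lg (tpure_bilin _ _).2. Qed.
Lemma lin_mulL V (A : algType k) (g : V -> A) c : lin g -> lin (fun x => g x * c).
Proof. by move=> lg a x y; rewrite lg mulrDl scalerAl. Qed.
Lemma lin_mulR V (A : algType k) c (g : V -> A) : lin g -> lin (fun x => c * g x).
Proof. by move=> lg a x y; rewrite lg mulrDr scalerAr. Qed.
Lemma lin_mulkL V (g : V -> k^o) (c : k) :
  lin g -> @lin V k^o (fun x => (g x : k) * c).
Proof. by move=> lg a x y; rewrite lg mulrDl -mulrA. Qed.
Lemma lin_mulkR V (c : k) (g : V -> k^o) :
  lin g -> @lin V k^o (fun x => c * (g x : k)).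
Proof. by move=> lg a x y; rewrite lg mulrDr mulrCA. Qed.
Lemma lin_scaleL V U (g : V -> k^o) (c : U) : lin g -> lin (fun x => (g x : k) *: c).
Proof. by move=> lg a x y; rewrite lg scalerDl scalerA. Qed.
Lemma lin_scaleR V U (c : k) (g : V -> U) : lin g -> lin (fun x => c *: g x).
Proof. by move=> lg a x y; rewrite lg scalerDr !scalerA mulrC. Qed.
Lemma lin_swP V W W' U (B : V -> W -> W' -> U) t :
  (forall a b, lin (fun x => B x a b)) -> lin (fun x => tlift (B x) t).
Proof.
move=> lB a x y; rewrite /tlift scaler_sumr -big_split.
by apply: eq_bigr => p _; rewrite lB.
Qed.
Lemma lin_swA V W W' U (B : W -> W' -> U) (g : V -> tens W W') :
  bilin B -> lin g -> lin (fun x => tlift B (g x)).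
Proof. by move=> bB lg a x y; rewrite lg tlift_lin. Qed.

Lemma scale_sw V W U (B : V -> W -> U) t (c : k) :
  c *: tlift B t = \sw_(a, b <- t) (c *: B a b).
Proof. by rewrite /tlift scaler_sumr. Qed.
Lemma mulr_sw V W (A : algType k) (B : V -> W -> A) t x :
  x * tlift B t = \sw_(a, b <- t) (x * B a b).
Proof. by rewrite /tlift mulr_sumr. Qed.
Lemma mull_sw V W (A : algType k) (B : V -> W -> A) t x :
  tlift B t * x = \sw_(a, b <- t) (B a b * x).
Proof. by rewrite /tlift mulr_suml. Qed.

End Multilinear.

(* The fallback of [lin1], redefined below to cover lhom, homT and hypotheses.  *)
Ltac lin_extra := fail.

Ltac lin1 :=
  match goal with
  | |- bilin _ => split=> ?
  | |- lin (fun x => x) => apply: lin_id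
  | |- lin (fun x => tpure (@?g x) ?c) => apply: (@lin_pureL _ _ _ _ g c)
  | |- lin (fun x => tpure ?c (@?g x)) => apply: (@lin_pureR _ _ _ _ c g)
  | |- lin (fun x => tlift (@?B x) ?t) =>
      apply: (@lin_swP _ _ _ _ _ B t) => ? ?
  | |- lin (fun x => tlift ?B (@?g x)) => apply: (@lin_swA _ _ _ _ _ B g)
  | |- lin (fun x => GRing.scale (@?g x) ?c) => apply: (@lin_scaleL _ _ _ g c)
  | |- lin (fun x => GRing.scale ?c (@?g x)) => apply: (@lin_scaleR _ _ _ c g)
  | |- lin (fun x => GRing.mul (@?g x) ?c) =>
      first [apply: (@lin_mulL _ _ _ g c) | apply: (@lin_mulkL _ _ g c)]
  | |- lin (fun x => GRing.mul ?c (@?g x)) =>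
      first [apply: (@lin_mulR _ _ _ c g) | apply: (@lin_mulkR _ _ c g)]
  | |- lin (fun x => GRing.Linear.sort ?f (@?g x)) => apply: (@lin_comp _ _ _ _ f g)
  | |- lin (GRing.Linear.sort ?f) => apply: linE
  | |- lin (tpure ?c) => apply: (@tpure_bilin _ _ _).2
  | |- lin (tlift ?B) => apply: (@tlift_lin _ _ _ _ B)
  end.
Ltac lint := solve [repeat (cbv beta; first [lin1 | lin_extra])].

Section Separation.
Variable k : fieldType.
Implicit Types U V W : lmodType k.
Local Open Scope classical_set_scope.

Definition subspace V (P : V -> Prop) :=
  P 0 /\ forall a x y, P x -> P y -> P (a *: x + y).

Lemma subsp_scale V (P : V -> Prop) a x : subspace P -> P x -> P (a *: x).
Proof. by move=> [P0 PD] Px; rewrite -[a *: x]addr0; apply: PD. Qed.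
Lemma subsp_add V (P : V -> Prop) x y : subspace P -> P x -> P y -> P (x + y).
Proof. by move=> [P0 PD] Px Py; rewrite -[x]scale1r; apply: PD. Qed.
Lemma subsp_sub V (P : V -> Prop) x y : subspace P -> P x -> P y -> P (x - y).
Proof. by move=> sP Px Py; rewrite addrC -scaleN1r; apply: sP.2. Qed.

Lemma sep_functional V (P : V -> Prop) (h : V) : subspace P -> ~ P h ->
  exists phi : V -> k^o, [/\ lin phi, phi h = 1 & forall x, P x -> phi x = 0].
Proof.
move=> sP Ph.
pose good (K : set V) := [/\ subspace K, P `<=` K & ~ K h].
have [F FQ Ftot|K [KQ Kmax]] :=
    @Zorn_bigcup V (fun K => K = set0 \/ good K).
  have [[X [FX gX]]|nF] := pselect (exists X, F X /\ good X); last first.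
    left; apply/seteqP; split=> // x [X FX Xx]; have [X0|gX] := FQ X FX.
      by rewrite X0 in Xx.
    by apply: nF; exists X.
  right; split; last first.
  - by move=> [Y FY Yh]; have [Y0|[_ _]] := FQ Y FY; [rewrite Y0 in Yh|apply].
  - by move=> x Px; exists X => //; case: gX => _ + _; apply.
  - split; first by exists X => //; case: gX => -[].
    move=> a x y [Y FY Yx] [Z FZ Zy].
    have [sYZ|sZY] := Ftot Y Z FY FZ.
      exists Z => //; have [Z0|[[_ ZD] _ _]] := FQ Z FZ.
        by rewrite Z0 in Zy.
      by apply: ZD => //; apply: sYZ.
    exists Y => //; have [Y0|[[_ YD] _ _]] := FQ Y FY.
      by rewrite Y0 in Yx.
    by apply: YD => //; apply: sZY.
have [K0|[sK PK Kh]] := KQ.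
  exfalso; apply: (Kmax P); last by right; split.
  rewrite K0; split=> // PS0; by have := PS0 0 sP.1.
have dec x : exists c, K (x - c *: h).
  have [Kx|Kx] := pselect (K x); first by exists 0; rewrite scale0r subr0.
  pose L : set V := fun y => exists a, K (y - a *: x).
  have sL : subspace L.
    split; first by exists 0; rewrite scale0r subr0; apply: sK.1.
    move=> a y z [b Ky] [c Kz]; exists (a * b + c).
    rewrite scalerDl -scalerA opprD addrACA -scalerBr; exact: sK.2.
  have KL : K `<=` L by move=> y Ky; exists 0; rewrite scale0r subr0.
  have Lx : L x by exists 1; rewrite scale1r subrr; apply: sK.1.
  have Lh : L h.
    apply: contrapT => nLh; apply: (Kmax L); last first.
      by right; split=> // y /PK /KL.
    by split=> // LK; apply: Kx; apply: LK.
  case: Lh => a Kha; have a0 : a != 0.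
    by apply: contra_notN Kh => /eqP a0; move: Kha; rewrite a0 scale0r subr0.
  exists a^-1; have -> : x - a^-1 *: h = - a^-1 *: (h - a *: x).
    rewrite scaleNr scalerBr scalerA mulVf // scale1r opprB //.
  exact: subsp_scale.
have [phi phiP] := choice dec.
have phi_uniq x c : K (x - c *: h) -> phi x = c.
  move=> Kc; apply/eqP; rewrite -subr_eq0; apply/negPn/negP => n0.
  apply: Kh; rewrite -[h]scale1r -(mulVf n0) -scalerA; apply: subsp_scale => //.
  have -> : (phi x - c) *: h = (x - c *: h) - (x - phi x *: h).
    by rewrite scalerBl opprB [RHS]addrC addrA subrK.
  exact: subsp_sub.
exists phi; split.
- move=> a x y; apply: phi_uniq; rewrite scalerDl -scalerA opprD addrACA -scalerBr.
  exact: sK.2.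
- by apply: phi_uniq; rewrite scale1r subrr; apply: sK.1.
- by move=> x /PK Kx; apply: phi_uniq; rewrite scale0r subr0.
Qed.

(* 1 (x) phi *)
Definition slice U V (phi : V -> k^o) (t : tens U V) : U :=
  \sw_(u, v <- t) (phi v *: u).

Lemma slice_bilin U V (phi : V -> k^o) : lin phi ->
  bilin (fun (u : U) v => (phi v : k) *: u).
Proof. by move=> lphi; split=> ? a x y; rewrite ?lphi (scalerDr, scalerDl) ?scalerA // mulrC. Qed.

Lemma slice_lin U V (phi : V -> k^o) : lin phi -> lin (@slice U V phi).
Proof. by move=> lphi; apply: tlift_lin; apply: slice_bilin. Qed.
Lemma slice_pure U V (phi : V -> k^o) (u : U) v :
  lin phi -> slice phi (u ⊗ v) = phi v *: u.
Proof. by move=> lphi; rewrite /slice tlift_pure //; apply: slice_bilin. Qed.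

Fixpoint lspan V (s : seq V) (x : V) : Prop :=
  if s is v :: s' then exists a, lspan s' (x - a *: v) else x = 0.

Lemma lspan_subspace V (s : seq V) : subspace (lspan s).
Proof.
elim: s => [|v s [IH0 IHD]]; split=> //=.
- by move=> a x y -> ->; rewrite scaler0 addr0.
- by exists 0; rewrite scale0r subr0.
- move=> a x y [b xb] [c yc]; exists (a * b + c).
  by rewrite scalerDl -scalerA opprD addrACA -scalerBr; apply: IHD.
Qed.

Lemma lspan_head V (v : V) s : lspan (v :: s) v.
Proof. by exists 1; rewrite scale1r subrr; apply: (lspan_subspace s).1. Qed.
Lemma lspan_tail V (v : V) s x : lspan s x -> lspan (v :: s) x.
Proof. by move=> sx; exists 0; rewrite scale0r subr0. Qed.

Lemma lspan_absorb U V (s : seq (U * V)) (u : U) (h : V) :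
  lspan (map snd s) h -> exists s' : seq (U * V), size s' = size s /\
    u ⊗ h + \sum_(p <- s) p.1 ⊗ p.2 = \sum_(p <- s') p.1 ⊗ p.2.
Proof.
elim: s u h => [|[u1 v] s IHs] u h /=.
  by move=> ->; exists [::]; rewrite !big_nil (lin_0 ((tpure_bilin _ _).2 u)) addr0.
move=> [a /(IHs u) [s' [ss' e]]]; exists ((u1 + a *: u, v) :: s').
split; first by rewrite /= ss'.
have eh : u ⊗ h = u ⊗ (h - a *: v) + a *: (u ⊗ v).
  by rewrite -tpureZr -tpureDr subrK.
rewrite !big_cons -e /= tpureDl tpureZl eh.
by rewrite [X in X + _ = _]addrC addrACA [X in X + _ = _]addrC.
Qed.

Lemma slice_subspace U V (P : U -> Prop) (t : tens U V) : subspace P ->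
  (forall phi, lin phi -> P (slice phi t)) ->
  exists s : seq (U * V), (forall p, p \in s -> P p.1) /\
     t = \sum_(p <- s) p.1 ⊗ p.2.
Proof.
move=> sP; rewrite -(reprK t) tens_pi.
move: (repr t) => s; have [n] := ubnP (size s); elim: n s => // n IHn [|[u h] s] /=.
  by move=> _ _; exists [::].
rewrite ltnS => ssn Pt.
have [sh|nsh] := pselect (lspan (map snd s) h).
  have [s' [ss' e]] := lspan_absorb u sh.
  move: Pt; rewrite big_cons e => Pt; apply: IHn => //; by rewrite ss'.
have [phi [lphi phih phis]] := sep_functional (lspan_subspace _) nsh.
have Pu : P u.
  have := Pt _ lphi; rewrite big_cons (lin_add _ _ (slice_lin lphi)).
  rewrite slice_pure // phih scale1r (lin_suml _ _ (slice_lin lphi)).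
  suff -> : \sum_(i <- s) slice phi (i.1 ⊗ i.2) = 0 by rewrite addr0.
  have : forall x, lspan (map snd s) x -> phi x = 0 by [].
  clear -lphi; elim: s => [|p s IHs] phis; first by rewrite big_nil.
  rewrite big_cons slice_pure // phis ?scale0r ?add0r; last exact: lspan_head.
  by apply: IHs => x sx; apply: phis; apply: lspan_tail.
have [|s' [Ps' e]] := IHn s ssn.
  move=> psi lpsi; have := Pt _ lpsi; rewrite big_cons (lin_add _ _ (slice_lin lpsi)).
  rewrite slice_pure // => /(subsp_sub sP) /(_ (subsp_scale (psi h) sP Pu)).
  by rewrite addrC addKr.
exists ((u, h) :: s'); split; last by rewrite !big_cons e.
by move=> p; rewrite inE => /predU1P [->|/Ps'].
Qed.

Lemma slice_inj U V (t t' : tens U V) :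
  (forall phi, lin phi -> slice phi t = slice phi t') -> t = t'.
Proof.
move=> e; apply/eqP; rewrite -subr_eq0; apply/eqP.
have s0 : subspace (fun x : U => x = 0).
  by split=> // a x y -> ->; rewrite scaler0 addr0.
have [|s [s0s ->]] := slice_subspace (t := t - t') s0.
  move=> phi lphi; rewrite (lin_add _ _ (slice_lin lphi)).
  by rewrite (lin_opp _ (slice_lin lphi)) e // subrr.
elim: s s0s => [|p s IHs] s0s; first by rewrite big_nil.
rewrite big_cons IHs ?addr0; last by move=> q qs; apply: s0s; rewrite inE qs orbT.
by rewrite (s0s p) ?(lin_0 ((tpure_bilin _ _).1 _)) // mem_head.
Qed.

End Separation.

Section LinearHom.
Variables (k : fieldType) (V W : lmodType k).

Definition linpred : {pred V -> W} := fun f => `[< lin f >].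
Lemma linpred_submod : submod_closed linpred.
Proof.
split; first by apply/asboolP => a x y; rewrite scaler0 addr0.
move=> a f g /asboolP lf /asboolP lg; apply/asboolP => b x y.
rewrite !fctE lf lg; rewrite !scalerDr !scalerA mulrC -!addrA; congr (_ + _).
by rewrite addrCA.
Qed.
HB.instance Definition _ :=
  GRing.isSubmodClosed.Build k (V -> W) linpred linpred_submod.

Record lhom := LHom { lhom_fun :> V -> W; lhom_subproof : lhom_fun \in linpred }.

HB.instance Definition _ := [isSub for lhom_fun].
HB.instance Definition _ := [Choice of lhom by <:].
HB.instance Definition _ := [SubChoice_isSubLmodule of lhom by <:].

Lemma lhomP (f : lhom) : lin f. Proof. by case: f => f /= /asboolP. Qed.
HB.instance Definition _ (f : lhom) := GRing.isLinear.Build k V W _ f (lhomP f).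

Definition mkLHom (f : V -> W) (lf : lin f) : lhom := LHom (asboolT lf).

Lemma lhom_eq (f g : lhom) : f =1 g -> f = g.
Proof. by move=> e; apply: val_inj; apply: funext. Qed.

Lemma lhom_app_lin (v : V) : lin (fun f : lhom => f v).
Proof. by []. Qed.

End LinearHom.

Ltac lin_extra ::=
  match goal with
  | |- lin (fun x => lhom_fun (@?f x) ?v) =>
      apply: (@lin_comph _ _ _ _ (fun g => lhom_fun g v) f (@lhom_app_lin _ _ _ v))
  | |- lin (fun x => lhom_fun ?f (@?g x)) =>
      apply: (@lin_comph _ _ _ _ (lhom_fun f) g (lhomP f))
  | H : lin ?f |- lin ?f => exact: H
  | H : lin ?f |- lin (fun x => ?f (@?g x)) => apply: (@lin_comph _ _ _ _ f g H)
  | H : bilin ?m |- lin (?m ?c) => exact: (H.2 c)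
  | H : bilin ?m |- lin (fun x => ?m (@?g x) ?c) =>
      apply: (@lin_comph _ _ _ _ (fun z => m z c) g (H.1 c))
  | H : bilin ?m |- lin (fun x => ?m ?c (@?g x)) =>
      apply: (@lin_comph _ _ _ _ (m c) g (H.2 c))
  end.

Record hopfAlgebra (k : fieldType) := HopfAlgebra {
  hopf_alg :> algType k;
  comul : {linear hopf_alg -> hopf_alg ⨂ hopf_alg};
  counit : {linear hopf_alg -> k^o};
  antipode : {linear hopf_alg -> hopf_alg};
  comulA : forall h, \sw_(h1, h2 <- comul h) \sw_(a, b <- comul h1) ((a ⊗ b) ⊗ h2)
                   = \sw_(h1, h2 <- comul h) \sw_(a, b <- comul h2) ((h1 ⊗ a) ⊗ b);
  counitL : forall h, \sw_(h1, h2 <- comul h) ((counit h1 : k) *: h2) = h;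
  counitR : forall h, \sw_(h1, h2 <- comul h) ((counit h2 : k) *: h1) = h;
  comul1 : comul 1 = 1 ⊗ 1;
  comulM : forall g h, comul (g * h)
         = \sw_(g1, g2 <- comul g) \sw_(h1, h2 <- comul h) ((g1 * h1) ⊗ (g2 * h2));
  counit1 : counit 1 = 1;
  counitM : forall g h, counit (g * h) = (counit g : k) * counit h;
  antipodeL : forall h, \sw_(h1, h2 <- comul h) (antipode h1 * h2) = (counit h : k) *: 1;
  antipodeR : forall h, \sw_(h1, h2 <- comul h) (h1 * antipode h2) = (counit h : k) *: 1
}.

Arguments comul {k _}.
Arguments counit {k _}.
Arguments antipode {k _}.

Section HopfTheory.
Variables (k : fieldType) (H : hopfAlgebra k).
Local Notation Δ := (@comul k H).
Local Notation ε := (@counit k H).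
Local Notation S := (@antipode k H).

Definition trilin (U1 U2 U3 U : lmodType k) (T : U1 -> U2 -> U3 -> U) :=
  [/\ forall b c, lin (fun a => T a b c), forall a c, lin (fun b => T a b c)
    & forall a b, lin (fun c => T a b c)].

Lemma trilin_lift (U1 U2 U3 U : lmodType k) (T : U1 -> U2 -> U3 -> U) :
  trilin T -> bilin (fun (x : U1 ⨂ U2) c => \sw_(a, b <- x) T a b c).
Proof.
move=> [T1 T2 T3]; split=> [c|x].
  by apply: tlift_lin; split=> ?; [apply: T1 | apply: T2].
by apply: (@lin_swP _ _ _ _ _ (fun c a b => T a b c)) => ? ?; apply: T3.
Qed.

Lemma trilin_pure (U1 U2 U3 U : lmodType k) (T : U1 -> U2 -> U3 -> U) a b c :
  trilin T -> \sw_(x, c <- (a ⊗ b) ⊗ c) \sw_(a, b <- x) T a b c = T a b c.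
Proof.
move=> tT; rewrite tlift_pure; last exact: trilin_lift.
by rewrite tlift_pure //; case: tT => T1 T2 _; split=> ?; [apply: T1 | apply: T2].
Qed.

Lemma coassocE (U1 U2 U3 U X Y : lmodType k) (T : U1 -> U2 -> U3 -> U)
    (t : X ⨂ U3) (f : X -> U1 ⨂ U2) (t' : U1 ⨂ Y) (g : Y -> U2 ⨂ U3) :
  \sw_(x, c <- t) \sw_(a, b <- f x) ((a ⊗ b) ⊗ c)
  = \sw_(a, y <- t') \sw_(b, c <- g y) ((a ⊗ b) ⊗ c) -> trilin T ->
  \sw_(x, c <- t) \sw_(a, b <- f x) T a b c
  = \sw_(a, y <- t') \sw_(b, c <- g y) T a b c.
Proof.
move=> e0 tT; have := congr1 (tlift (fun x c => \sw_(a, b <- x) T a b c)) e0.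
rewrite !(sw_sw _ _ (trilin_lift tT)).
have e x y : tlift (fun c d => \sw_(a, b <- c) T a b d)
   (\sw_(a, b <- x) ((a ⊗ b) ⊗ y)) = \sw_(a, b <- x) T a b y.
  by rewrite (sw_sw _ _ (trilin_lift tT)); apply: eq_sw => a b; apply: trilin_pure.
have e' x y : tlift (fun c d => \sw_(a, b <- c) T a b d)
   (\sw_(a, b <- x) ((y ⊗ a) ⊗ b)) = \sw_(a, b <- x) T y a b.
  by rewrite (sw_sw _ _ (trilin_lift tT)); apply: eq_sw => a b; apply: trilin_pure.
under eq_sw => a b do rewrite e.
by under [in RHS]eq_sw => a b do rewrite e'.
Qed.

Lemma comulE (U : lmodType k) (T : H -> H -> H -> U) h : trilin T ->
  \sw_(h1, h2 <- Δ h) \sw_(a, b <- Δ h1) T a b h2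
  = \sw_(h1, h2 <- Δ h) \sw_(a, b <- Δ h2) T h1 a b.
Proof. exact/coassocE/comulA. Qed.

Lemma counitLE (U : lmodType k) (f : H -> U) h : lin f ->
  \sw_(h1, h2 <- Δ h) ((ε h1 : k) *: f h2) = f h.
Proof.
move=> lf; rewrite -[in RHS](counitL h) (lin_sw _ _ lf).
by apply: eq_sw => a b; rewrite lin_scale.
Qed.
Lemma counitRE (U : lmodType k) (f : H -> U) h : lin f ->
  \sw_(h1, h2 <- Δ h) ((ε h2 : k) *: f h1) = f h.
Proof.
move=> lf; rewrite -[in RHS](counitR h) (lin_sw _ _ lf).
by apply: eq_sw => a b; rewrite lin_scale.
Qed.

Lemma conv_uniq (A : lmodType k) (mul : A -> A -> A) (e : A) (L F R : H -> A) :
  bilin mul -> associative mul -> left_id e mul -> right_id e mul ->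
  lin L -> lin F -> lin R ->
  (forall h, \sw_(h1, h2 <- Δ h) mul (L h1) (F h2) = (ε h : k) *: e) ->
  (forall h, \sw_(h1, h2 <- Δ h) mul (F h1) (R h2) = (ε h : k) *: e) ->
  L =1 R.
Proof.
move=> bm mA m1l m1r lL lF lR LF FR h.
rewrite -[LHS](counitRE _ lL) -[RHS](counitLE _ lR).
transitivity (\sw_(h1, h2 <- Δ h) \sw_(a, b <- Δ h2) mul (mul (L h1) (F a)) (R b)).
  apply: eq_sw => h1 h2; under eq_sw => a b do rewrite -mA.
  rewrite -(lin_sw _ _ (bm.2 _)) FR (lin_scale _ _ (bm.2 _)) m1r //.
rewrite -(comulE (T := fun x a b => mul (mul (L x) (F a)) (R b))).
  apply: eq_sw => h1 h2.
  rewrite -(lin_sw (fun a b => mul (L a) (F b)) _ (bm.1 (R h2))) LF.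
  by rewrite (lin_scale _ _ (bm.1 _)) m1l.
by split=> ? ?; lint.
Qed.

Definition tmul (x y : H ⨂ H) : H ⨂ H :=
  \sw_(a, b <- x) \sw_(c, d <- y) ((a * c) ⊗ (b * d)).

Lemma tmul_bilin : bilin tmul.
Proof. by split=> ?; rewrite /tmul; lint. Qed.

Lemma tmul_pure a b c d : tmul (a ⊗ b) (c ⊗ d) = (a * c) ⊗ (b * d).
Proof.
rewrite /tmul tlift_pure; last by lint.
by rewrite tlift_pure; last by lint.
Qed.

Lemma tens_ext (U V W : lmodType k) (f g : U ⨂ V -> W) : lin f -> lin g ->
  (forall a b, f (a ⊗ b) = g (a ⊗ b)) -> f =1 g.
Proof.
move=> lf lg e t; rewrite -(sw_id t) (lin_sw _ _ lf) (lin_sw _ _ lg).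
exact: eq_sw.
Qed.

Lemma tmul1l : left_id (1 ⊗ 1) tmul.
Proof.
have b := tmul_bilin.
apply: (tens_ext (f := tmul (1 ⊗ 1)) (g := fun x => x)) => [||x y]; [by lint|by lint|].
by rewrite tmul_pure !mul1r.
Qed.
Lemma tmul1r : right_id (1 ⊗ 1) tmul.
Proof.
have b := tmul_bilin.
apply: (tens_ext (f := fun x => tmul x (1 ⊗ 1)) (g := fun x => x)) => [||x y]; [by lint|by lint|].
by rewrite tmul_pure !mulr1.
Qed.
Lemma tmulA : associative tmul.
Proof.
have b := tmul_bilin => x y z.
apply: (tens_ext (f := fun x => tmul x (tmul y z))
                 (g := fun x => tmul (tmul x y) z)); try by lint.
move=> a1 a2.
apply: (tens_ext (f := fun y => tmul (a1 ⊗ a2) (tmul y z))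
                 (g := fun y => tmul (tmul (a1 ⊗ a2) y) z)); try by lint.
move=> b1 b2.
apply: (tens_ext (f := fun z => tmul (a1 ⊗ a2) (tmul (b1 ⊗ b2) z))
                 (g := fun z => tmul (tmul (a1 ⊗ a2) (b1 ⊗ b2)) z)); try by lint.
by move=> c1 c2; rewrite !tmul_pure !mulrA.
Qed.

Lemma antipode_comul h : Δ (S h) = \sw_(h1, h2 <- Δ h) (S h2 ⊗ S h1).
Proof.
have b := tmul_bilin.
pose R h := \sw_(h1, h2 <- Δ h) (S h2 ⊗ S h1).
apply: (conv_uniq (L := fun h => Δ (S h)) (F := Δ) (R := R) b tmulA tmul1l tmul1r);
  try by rewrite /R; lint.
  move=> {}h; under eq_sw => h1 h2 do rewrite /tmul -comulM.
  by rewrite -(lin_sw _ _ (linE Δ)) antipodeL linearZ comul1.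
move=> {}h; rewrite /R.
transitivity (\sw_(h1, h2 <- Δ h) \sw_(a, b <- Δ h1) \sw_(x, y <- Δ h2)
     ((a * S y) ⊗ (b * S x))).
  apply: eq_sw => h1 h2.
  rewrite (lin_sw _ _ (b.2 _)) sw_swap; apply: eq_sw => x y.
  rewrite /tmul; apply: eq_sw => c d; rewrite tlift_pure //; by lint.
rewrite (comulE (T := fun a b h2 => \sw_(x, y <- Δ h2) ((a * S y) ⊗ (b * S x))));
  last by split=> ? ?; lint.
transitivity (\sw_(a, r <- Δ h) ((a * S r) ⊗ 1 : H ⨂ H)); last first.
  by rewrite -(lin_sw _ _ ((tpure_bilin _ _).1 1)) antipodeR tpureZl.
apply: eq_sw => a r.
rewrite -(comulE (T := fun b x y => (a * S y) ⊗ (b * S x)));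
  last by split=> ? ?; lint.
rewrite -(counitLE (f := fun r => (a * S r) ⊗ (1 : H)) r); last by lint.
apply: eq_sw => q y.
by rewrite -(lin_sw _ _ ((tpure_bilin _ _).2 _)) antipodeR tpureZr.
Qed.

Lemma antipode_counit h : ε (S h) = ε h.
Proof.
have e1 : \sw_(h1, h2 <- Δ h) (ε h2 *: ε (S h1) : k^o) = ε (S h).
  by rewrite (counitRE (f := fun h => ε (S h))); last by lint.
rewrite -e1 -[RHS](_ : ε (\sw_(h1, h2 <- Δ h) (S h1 * h2)) = ε h); last first.
  by rewrite antipodeL linearZ /= counit1 [LHS]mulr1.
rewrite (lin_sw _ _ (linE ε)); apply: eq_sw => a b.
by rewrite counitM mulrC.
Qed.

End HopfTheory.

Definition mkLinear (k : fieldType) (V W : lmodType k) (f : V -> W) (lf : lin f) :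
  {linear V -> W} := HB.pack f (GRing.isLinear.Build k V W *:%R f lf).

Section Comodules.
Variables (k : fieldType) (H : hopfAlgebra k).
Local Notation Δ := (@comul k H).
Local Notation ε := (@counit k H).
Local Notation S := (@antipode k H).

Record comod := Comod {
  comod_car :> lmodType k;
  coact : {linear comod_car -> comod_car ⨂ H};
  coactA : forall m, \sw_(m0, m1 <- coact m) \sw_(a, b <- coact m0) ((a ⊗ b) ⊗ m1)
                   = \sw_(m0, m1 <- coact m) \sw_(a, b <- comul m1) ((m0 ⊗ a) ⊗ b);
  coact_counit : forall m, \sw_(m0, m1 <- coact m) ((counit m1 : k) *: m0) = m
}.


#[global] Arguments coact {_} : rename.

Lemma coactE (M : comod) (U : lmodType k) (T : M -> H -> H -> U) m : trilin T ->
  \sw_(m0, m1 <- coact m) \sw_(a, b <- coact m0) T a b m1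
  = \sw_(m0, m1 <- coact m) \sw_(a, b <- Δ m1) T m0 a b.
Proof. exact/coassocE/coactA. Qed.

Lemma coact_counitE (M : comod) (U : lmodType k) (f : M -> U) m : lin f ->
  \sw_(m0, m1 <- coact m) ((ε m1 : k) *: f m0) = f m.
Proof.
move=> lf; rewrite -[in RHS](coact_counit m) (lin_sw _ _ lf).
by apply: eq_sw => a b; rewrite lin_scale.
Qed.

Record chom (M N : comod) := CHom {
  chom_lhom :> lhom M N;
  chom_colin : forall m, coact (chom_lhom m) = \sw_(m0, m1 <- coact m) (chom_lhom m0 ⊗ m1)
}.

Lemma chom_eq (M N : comod) (f g : chom M N) : f =1 g -> f = g.
Proof.
case: f g => [f cf] [g cg] /= e; have fg : f = g by apply: lhom_eq.
by rewrite -fg in cg *; rewrite (Prop_irrelevance cf cg).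
Qed.

Definition mkCHom (M N : comod) (f : M -> N) (lf : lin f)
  (cf : forall m, coact (f m) = \sw_(m0, m1 <- coact m) (f m0 ⊗ m1)) : chom M N :=
  @CHom M N (mkLHom lf) cf.

Lemma cid_colin (M : comod) (m : M) :
  coact m = \sw_(m0, m1 <- coact m) (m0 ⊗ m1).
Proof. by rewrite sw_id. Qed.
Definition chom_id (M : comod) : chom M M := mkCHom (@lin_id k M) (@cid_colin M).

Section Comp.
Variables (M N P : comod) (g : chom N P) (f : chom M N).
Lemma ccomp_lin : lin (fun m => g (f m)). Proof. by lint. Qed.
Lemma ccomp_colin m : coact (g (f m)) = \sw_(m0, m1 <- coact m) (g (f m0) ⊗ m1).
Proof.
rewrite chom_colin chom_colin sw_sw; last by lint.
by apply: eq_sw => a b; rewrite tlift_pure //; lint.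
Qed.
Definition chom_comp : chom M P := mkCHom ccomp_lin ccomp_colin.
End Comp.

Lemma chom_compA (M N P Q : comod) (h : chom P Q) (g : chom N P) (f : chom M N) :
  chom_comp h (chom_comp g f) = chom_comp (chom_comp h g) f.
Proof. exact: chom_eq. Qed.

Definition chom_iso (M N : comod) (f : chom M N) :=
  exists g : chom N M, chom_comp g f = chom_id M /\ chom_comp f g = chom_id N.

Section UnitComodule.
Definition unit_coact_fun (a : k^o) : k^o ⨂ H := a ⊗ 1.
Lemma unit_coact_lin : lin unit_coact_fun.
Proof. by rewrite /unit_coact_fun; lint. Qed.
Lemma unit_coactA (a : k^o) :
  \sw_(m0, m1 <- unit_coact_fun a) \sw_(a, b <- unit_coact_fun m0) ((a ⊗ b) ⊗ m1)
  = \sw_(m0, m1 <- unit_coact_fun a) \sw_(a, b <- Δ m1) ((m0 ⊗ a) ⊗ b).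
Proof.
have lu := unit_coact_lin.
rewrite !tlift_pure; try by lint.
by rewrite comul1 tlift_pure //; lint.
Qed.
Lemma unit_coact_counit (a : k^o) :
  \sw_(m0, m1 <- unit_coact_fun a) ((ε m1 : k) *: m0) = a.
Proof. by rewrite tlift_pure; [rewrite counit1 scale1r|lint]. Qed.
Definition unit_comod : comod :=
  @Comod k^o (mkLinear unit_coact_lin) unit_coactA unit_coact_counit.
End UnitComodule.

Section TensorComodule.
Variables (M N : comod).
Definition tens_coact_fun (t : M ⨂ N) : (M ⨂ N) ⨂ H :=
  \sw_(m, n <- t) \sw_(m0, m1 <- coact m) \sw_(n0, n1 <- coact n)
    ((m0 ⊗ n0) ⊗ (m1 * n1)).
Lemma tens_coact_bilin : bilin (fun (m : M) (n : N) =>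
  \sw_(m0, m1 <- coact m) \sw_(n0, n1 <- coact n) ((m0 ⊗ n0) ⊗ (m1 * n1))).
Proof. by lint. Qed.
Lemma tens_coact_lin : lin tens_coact_fun.
Proof. by rewrite /tens_coact_fun; lint. Qed.
Lemma tens_coact_pure m n : tens_coact_fun (m ⊗ n) =
  \sw_(m0, m1 <- coact m) \sw_(n0, n1 <- coact n) ((m0 ⊗ n0) ⊗ (m1 * n1)).
Proof. by rewrite /tens_coact_fun tlift_pure //; apply: tens_coact_bilin. Qed.

Lemma tens_coactA t :
  \sw_(m0, m1 <- tens_coact_fun t) \sw_(a, b <- tens_coact_fun m0) ((a ⊗ b) ⊗ m1)
  = \sw_(m0, m1 <- tens_coact_fun t) \sw_(a, b <- Δ m1) ((m0 ⊗ a) ⊗ b).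
Proof.
have ll := tens_coact_lin.
move: t; apply: (tens_ext
 (f := fun t => \sw_(m0, m1 <- tens_coact_fun t) \sw_(a, b <- tens_coact_fun m0) ((a ⊗ b) ⊗ m1))
 (g := fun t => \sw_(m0, m1 <- tens_coact_fun t) \sw_(a, b <- Δ m1) ((m0 ⊗ a) ⊗ b)));
  [by lint|by lint|move=> m n].
rewrite tens_coact_pure.
transitivity (\sw_(m0, m1 <- coact m) \sw_(c, d <- coact m0)
  \sw_(n0, n1 <- coact n) \sw_(x, y <- coact n0)
    (((c ⊗ x) ⊗ (d * y)) ⊗ (m1 * n1))).
  rewrite sw_sw; last by lint.
  apply: eq_sw => m0 m1; rewrite sw_sw; last by lint.
  rewrite [RHS]sw_swap; apply: eq_sw => n0 n1.
  rewrite tlift_pure; last by lint.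
  rewrite tens_coact_pure sw_sw; last by lint.
  apply: eq_sw => c d; rewrite sw_sw; last by lint.
  by apply: eq_sw => x y; rewrite tlift_pure //; lint.
rewrite (coactE (T := fun c d m1 => \sw_(n0, n1 <- coact n) \sw_(x, y <- coact n0)
    (((c ⊗ x) ⊗ (d * y)) ⊗ (m1 * n1)))); last by split=> ? ?; lint.
rewrite sw_sw; last by lint.
apply: eq_sw => m0 m1; rewrite sw_sw; last by lint.
transitivity (\sw_(a, b <- Δ m1) \sw_(n0, n1 <- coact n) \sw_(x, y <- Δ n1)
    (((m0 ⊗ n0) ⊗ (a * x)) ⊗ (b * y))).
  apply: eq_sw => a b; rewrite (coactE (T := fun n0 y n1 =>
     (((m0 ⊗ n0) ⊗ (a * y)) ⊗ (b * n1)))) //; by split=> ? ?; lint.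
rewrite sw_swap; apply: eq_sw => n0 n1.
rewrite tlift_pure; last by lint.
rewrite comulM sw_sw; last by lint.
apply: eq_sw => a b; rewrite sw_sw; last by lint.
by apply: eq_sw => x y; rewrite tlift_pure //; lint.
Qed.

Lemma tens_coact_counit t : \sw_(m0, m1 <- tens_coact_fun t) ((ε m1 : k) *: m0) = t.
Proof.
have ll := tens_coact_lin.
move: t; apply: (tens_ext
 (f := fun t => \sw_(m0, m1 <- tens_coact_fun t) ((ε m1 : k) *: m0))
 (g := fun t => t)); [by lint|by lint|move=> m n].
rewrite tens_coact_pure sw_sw; last by lint.
rewrite -[in RHS](coact_counit m) (lin_sw _ _ ((tpure_bilin _ _).1 n)).
apply: eq_sw => m0 m1; rewrite sw_sw; last by lint.
rewrite -[in RHS](coact_counit n) (lin_sw _ _ ((tpure_bilin _ _).2 _)).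
apply: eq_sw => n0 n1; rewrite tlift_pure; last by lint.
by rewrite counitM tpureZl tpureZr scalerA.
Qed.

Definition tens_comod : comod :=
  @Comod (M ⨂ N) (mkLinear tens_coact_lin) tens_coactA tens_coact_counit.

Lemma tens_comodE (m : M) (n : N) : @coact tens_comod (m ⊗ n) =
  \sw_(m0, m1 <- coact m) \sw_(n0, n1 <- coact n) ((m0 ⊗ n0) ⊗ (m1 * n1)).
Proof. exact: tens_coact_pure. Qed.
End TensorComodule.

End Comodules.

Arguments coact {k H _}.

Section InternalHom.
Variables (k : fieldType) (H : hopfAlgebra k).
Local Notation Δ := (@comul k H).
Local Notation ε := (@counit k H).
Local Notation S := (@antipode k H).

(* The two internal Homs are treated together: they only differ by the way the  *)
(* coactions of the target and of the source are combined, which is             *)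
(* (v, w) |-> v * S w for Hom^l and (v, w) |-> S^-1 w * v for Hom^r.            *)
Record twist := Twist {
  tw :> H -> H -> H;
  tw_bilin : bilin tw;
  tw_comul : forall a b, Δ (tw a b)
    = \sw_(a1, a2 <- Δ a) \sw_(b1, b2 <- Δ b) (tw a1 b2 ⊗ tw a2 b1);
  tw_counit : forall a b, ε (tw a b) = (ε a : k) * ε b
}.

Section Twisted.
Variables (T : twist) (W V : comod H).

Definition rhoT (f : lhom W V) (w : W) : V ⨂ H :=
  \sw_(w0, w1 <- coact w) \sw_(v0, v1 <- coact (f w0)) (v0 ⊗ T v1 w1).

Let bT := tw_bilin T.

Lemma rhoT_lin w : lin (rhoT^~ w).
Proof. by have b := bT; rewrite /rhoT; lint. Qed.

Section Evaluation.
Variables (U : lmodType k) (ev : U -> lhom W V).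
Hypothesis lev : lin ev.
Hypothesis iev : injective ev.

Definition canT (t : U ⨂ H) (w : W) : V ⨂ H := \sw_(u, h <- t) (ev u w ⊗ h).

Lemma canT_lin w : lin (canT^~ w).
Proof. by have l := lev; rewrite /canT; lint. Qed.

Lemma slice_canT phi t w : lin phi -> slice phi (canT t w) = ev (slice phi t) w.
Proof.
move=> lphi; have l := lev; rewrite /canT (lin_sw _ _ (slice_lin lphi)) /slice (lin_sw _ _ lev).
rewrite (lin_sw _ _ (@lhom_app_lin _ _ _ w)).
by apply: eq_sw => u h; rewrite [LHS]slice_pure // lin_scale.
Qed.

Lemma canT_inj t t' : canT t =1 canT t' -> t = t'.
Proof.
move=> e; apply: slice_inj => phi lphi; apply: iev; apply: lhom_eq => w.
by rewrite -!slice_canT // e.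
Qed.

Lemma canT_key (f : lhom W V) (t : U ⨂ H) : canT t =1 rhoT f -> forall w,
  \sw_(g, h <- t) (rhoT (ev g) w ⊗ h)
  = \sw_(g, h <- t) \sw_(a, b <- Δ h) ((ev g w ⊗ a) ⊗ b).
Proof.
move=> e w; have l := lev; have b := bT.
pose Psi w1 (v : V) (h : H) := \sw_(v0, v1 <- coact v) ((v0 ⊗ T v1 w1) ⊗ h).
have bPsi w1 : bilin (Psi w1) by rewrite /Psi; lint.
transitivity (\sw_(w0, w1 <- coact w) \sw_(v, h <- canT t w0) Psi w1 v h).
  rewrite /canT /rhoT.
  under eq_sw => g h do rewrite (lin_sw _ _ ((tpure_bilin _ _).1 h)).
  rewrite sw_swap; apply: eq_sw => w0 w1; rewrite sw_sw //.
  apply: eq_sw => g h; rewrite (tlift_pure _ _ (bPsi _)).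
  by rewrite (lin_sw _ _ ((tpure_bilin _ _).1 h)).
transitivity (\sw_(w0, w1 <- coact w) \sw_(x, y <- coact w0)
   \sw_(v0, v1 <- coact (f x)) \sw_(c, d <- Δ v1) ((v0 ⊗ T c w1) ⊗ T d y)).
  apply: eq_sw => w0 w1; rewrite e /rhoT sw_sw //; apply: eq_sw => x y.
  rewrite sw_sw //.
  rewrite -(coactE (T := fun v0 c d => ((v0 ⊗ T c w1) ⊗ T d y))); last first.
    by split=> ? ?; lint.
  by apply: eq_sw => v0 v1; rewrite (tlift_pure _ _ (bPsi _)).
rewrite (coactE (T := fun x y w1 =>
   \sw_(v0, v1 <- coact (f x)) \sw_(c, d <- Δ v1) ((v0 ⊗ T c w1) ⊗ T d y))); last first.
  by split=> ? ?; lint.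
transitivity (\sw_(v, h <- canT t w) \sw_(a, b <- Δ h) ((v ⊗ a) ⊗ b)); last first.
  rewrite /canT sw_sw; last by lint.
  by apply: eq_sw => g h; rewrite tlift_pure //; lint.
rewrite e /rhoT sw_sw; last by lint.
apply: eq_sw => w0 w1; rewrite sw_sw; last by lint.
rewrite sw_swap; apply: eq_sw => v0 v1.
rewrite tlift_pure; last by lint.
rewrite tw_comul sw_sw; last by lint.
rewrite sw_swap; apply: eq_sw => c d; rewrite sw_sw; last by lint.
by apply: eq_sw => x y; rewrite tlift_pure //; lint.
Qed.

End Evaluation.

(* f such that rho f lies in (the image of) Hom(W, V) (x) H in Hom(W, V (x) H)  *)
Definition homT_pred : {pred lhom W V} := fun f =>
  `[< exists t : lhom W V ⨂ H, forall w, \sw_(g, h <- t) ((g : lhom W V) w ⊗ h) = rhoT f w >].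

Lemma homT_submod : submod_closed homT_pred.
Proof.
split.
  apply/asboolP; exists 0 => w.
  rewrite (lin_0 (rhoT_lin w)).
  exact: (lin_0 (canT_lin (@lin_id _ (lhom W V)) w)).
move=> a f g /asboolP [t et] /asboolP [u eu]; apply/asboolP; exists (a *: t + u) => w.
rewrite (rhoT_lin w) -et -eu; exact: (canT_lin (@lin_id _ (lhom W V)) w).
Qed.
HB.instance Definition _ :=
  GRing.isSubmodClosed.Build k (lhom W V) homT_pred homT_submod.

Record homT := HomT { homT_lhom :> lhom W V; homT_subproof : homT_lhom \in homT_pred }.
HB.instance Definition _ := [isSub for homT_lhom].
HB.instance Definition _ := [Choice of homT by <:].
HB.instance Definition _ := [SubChoice_isSubLmodule of homT by <:].

Lemma homT_lhom_lin : lin homT_lhom. Proof. by []. Qed.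

Lemma homT_eq (f g : homT) : f =1 g -> f = g.
Proof. by move=> e; apply: val_inj; apply: lhom_eq. Qed.

Lemma homT_slice (f t : _) phi : canT id t =1 rhoT f -> lin phi ->
  slice phi t \in homT_pred.
Proof.
move=> e lphi; apply/asboolP.
exists (\sw_(g, h <- t) \sw_(a, b <- Δ h) ((phi b : k) *: (g ⊗ a))) => w.
have := canT_key (@lin_id _ _) e w; move/(congr1 (slice phi)).
rewrite !(lin_sw _ _ (slice_lin lphi)).
under eq_sw => g h do rewrite slice_pure //.
under [in X in _ = X -> _]eq_sw => g h do rewrite (lin_sw _ _ (slice_lin lphi)).
move=> e'; transitivity (\sw_(g, h <- t) ((phi h : k) *: rhoT g w)); last first.
  rewrite /slice (lin_sw _ _ (rhoT_lin w)).
  by apply: eq_sw => g h; rewrite (lin_scale _ _ (rhoT_lin w)).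
rewrite e' -/(canT id _ w) (lin_sw _ _ (canT_lin (@lin_id _ _) w)).
apply: eq_sw => g h; rewrite (lin_sw _ _ (canT_lin (@lin_id _ _) w)).
apply: eq_sw => a b; rewrite (lin_scale _ _ (canT_lin (@lin_id _ _) w)) slice_pure //.
by rewrite /canT tlift_pure //; lint.
Qed.

Lemma homT_coact_ex (f : homT) : exists t : homT ⨂ H, canT homT_lhom t =1 rhoT f.
Proof.
have /asboolP [t et] := homT_subproof f.
have sP : subspace (fun g : lhom W V => g \in homT_pred).
  by split=> [|a x y xP yP]; [apply: rpred0 | apply: rpredD => //; apply: rpredZ].
have [s [sP' ts]] := slice_subspace sP (fun phi lphi => homT_slice et lphi).
have {ts}et w : \sum_(p <- s) p.1 w ⊗ p.2 = rhoT f w.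
  rewrite -et -/(canT id t w) ts (lin_suml _ _ (canT_lin (@lin_id _ _) w)).
  by apply: eq_bigr => p _; rewrite /canT tlift_pure //; lint.
have [s' es'] : exists s' : seq (homT * H), s = [seq (homT_lhom p.1, p.2) | p <- s'].
  elim: s sP' {et} => [|p s IHs] sP'; first by exists [::].
  have [|s' ->] := IHs; first by move=> q qs; apply: sP'; rewrite inE qs orbT.
  by exists ((HomT (sP' p (mem_head _ _)), p.2) :: s'); case: p sP'.
exists (\sum_(p <- s') p.1 ⊗ p.2) => w.
rewrite -et es' big_map (lin_suml _ _ (canT_lin homT_lhom_lin w)).
apply: eq_bigr => p _; rewrite /canT tlift_pure //.
split=> z; last by apply: (tpure_bilin _ _).2.
apply: (@lin_comph _ _ _ _ (fun v : V => v ⊗ z) (fun g : homT => g w)).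
  exact: (tpure_bilin _ _).1.
exact: (lin_comph (@lhom_app_lin _ _ _ w) homT_lhom_lin).
Qed.

Definition homT_coact_fun (f : homT) : homT ⨂ H := sval (cid (homT_coact_ex f)).

Lemma homT_coactP (f : homT) w :
  \sw_(g, h <- homT_coact_fun f) ((g : homT) w ⊗ h) = rhoT f w.
Proof. by rewrite /homT_coact_fun; case: cid => t /= e; exact: e. Qed.

Lemma homT_lhom_inj : injective homT_lhom. Proof. exact: val_inj. Qed.

Lemma homT_coact_lin : lin homT_coact_fun.
Proof.
move=> a f g; apply: (canT_inj homT_lhom_lin homT_lhom_inj) => w.
rewrite (canT_lin homT_lhom_lin w) /canT !homT_coactP.
exact: rhoT_lin.
Qed.

Lemma homT_coactA f :
  \sw_(m0, m1 <- homT_coact_fun f) \sw_(a, b <- homT_coact_fun m0) ((a ⊗ b) ⊗ m1)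
  = \sw_(m0, m1 <- homT_coact_fun f) \sw_(a, b <- Δ m1) ((m0 ⊗ a) ⊗ b).
Proof.
pose can2 (x : (homT ⨂ H) ⨂ H) w := \sw_(y, c <- x) (canT homT_lhom y w ⊗ c).
have lcan := canT_lin homT_lhom_lin.
have bcan w : bilin (fun y c => canT homT_lhom y w ⊗ (c : H)).
  split=> z; last exact: (tpure_bilin _ _).2.
  exact: (lin_comph ((tpure_bilin _ _).1 z) (lcan w)).
have lcan2 w : lin (can2^~ w) by apply: tlift_lin.
have can2_inj x y : can2 x =1 can2 y -> x = y.
  move=> e; apply: slice_inj => phi lphi.
  apply: (canT_inj homT_lhom_lin homT_lhom_inj) => w.
  have sE z : canT homT_lhom (slice phi z) w = slice phi (can2 z w).
    rewrite /can2 (lin_sw _ _ (slice_lin lphi)) {1}/slice (lin_sw _ _ (lcan w)).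
    by apply: eq_sw => g h; rewrite (lin_scale _ _ (lcan w)) slice_pure.
  by rewrite !sE e.
have can_pure g h w : canT homT_lhom (g ⊗ h) w = g w ⊗ h.
  rewrite /canT tlift_pure //; split=> z; last exact: (tpure_bilin _ _).2.
  apply: (@lin_comph _ _ _ _ (fun v : V => v ⊗ z) (fun g : homT => g w)).
    exact: (tpure_bilin _ _).1.
  exact: (lin_comph (@lhom_app_lin _ _ _ w) homT_lhom_lin).
apply: can2_inj => w; rewrite !(lin_sw _ _ (lcan2 w)).
transitivity (\sw_(g, h <- homT_coact_fun f) (rhoT (g : homT) w ⊗ h)).
  apply: eq_sw => g h; rewrite (lin_sw _ _ (lcan2 w)) -homT_coactP.
  rewrite (lin_sw _ _ ((tpure_bilin _ _).1 h)); apply: eq_sw => a b.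
  by rewrite /can2 tlift_pure // can_pure.
rewrite (canT_key homT_lhom_lin (f := f) (homT_coactP f)).
apply: eq_sw => g h; rewrite (lin_sw _ _ (lcan2 w)).
by apply: eq_sw => a b; rewrite /can2 tlift_pure // can_pure.
Qed.

Lemma homT_coact_counit f : \sw_(m0, m1 <- homT_coact_fun f) ((ε m1 : k) *: m0) = f.
Proof.
have b := bT.
apply: homT_eq => w.
have lw : lin (fun g : homT => g w).
  exact: (lin_comph (@lhom_app_lin _ _ _ w) homT_lhom_lin).
rewrite (lin_sw _ _ lw).
transitivity (\sw_(v, h <- rhoT f w) ((ε h : k) *: v)).
  rewrite -homT_coactP sw_sw; last by lint.
  apply: eq_sw => g h; rewrite (lin_scale _ _ lw) tlift_pure //; by lint.
rewrite /rhoT sw_sw; last by lint.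
rewrite -(coact_counitE (f := f) w); last exact: lhomP.
apply: eq_sw => w0 w1; rewrite sw_sw; last by lint.
rewrite -(coact_counitE (f := fun v => (ε w1 : k) *: v) (f w0)); last by lint.
apply: eq_sw => v0 v1; rewrite tlift_pure; last by lint.
by rewrite tw_counit scalerA.
Qed.

Definition homT_comod : comod H :=
  @Comod k H homT (mkLinear homT_coact_lin) homT_coactA homT_coact_counit.

Lemma homT_comodE (f : homT_comod) w :
  \sw_(g, h <- coact f) ((g : homT) w ⊗ h) = rhoT f w.
Proof. exact: homT_coactP. Qed.

End Twisted.
End InternalHom.

Ltac lin_extra ::=
  match goal with
  | |- lin (fun x => lhom_fun (@?f x) ?v) =>
      apply: (@lin_comph _ _ _ _ (fun g => lhom_fun g v) f (@lhom_app_lin _ _ _ v))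
  | |- lin (fun x => lhom_fun ?f (@?g x)) =>
      apply: (@lin_comph _ _ _ _ (lhom_fun f) g (lhomP f))
  | |- lin (lhom_fun ?f) => exact: (lhomP f)
  | |- lin (fun x => homT_lhom (@?g x)) =>
      apply: (@lin_comph _ _ _ _ (@homT_lhom _ _ _ _ _) g (@homT_lhom_lin _ _ _ _ _))
  | |- lin (@homT_lhom _ _ _ _ _) => apply: homT_lhom_lin
  | H : lin ?f |- lin ?f => exact: H
  | H : lin ?f |- lin (fun x => ?f (@?g x)) => apply: (@lin_comph _ _ _ _ f g H)
  | H : bilin ?m |- lin (?m ?c) => exact: (H.2 c)
  | H : bilin ?m |- lin (fun x => ?m (@?g x) ?c) =>
      apply: (@lin_comph _ _ _ _ (fun z => m z c) g (H.1 c))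
  | H : bilin ?m |- lin (fun x => ?m ?c (@?g x)) =>
      apply: (@lin_comph _ _ _ _ (m c) g (H.2 c))
  end.

Section HomLift.
Variables (k : fieldType) (H : hopfAlgebra k) (T : twist H).
Variables (X M A : comod H) (b : A -> lhom X M).
Hypothesis lb : lin b.
Hypothesis hb : forall a x, \sw_(a0, a1 <- coact a) (b a0 x ⊗ a1) = rhoT T (b a) x.

Lemma homT_lift_subproof a : b a \in @homT_pred _ _ T X M.
Proof.
apply/asboolP; exists (\sw_(a0, a1 <- coact a) (b a0 ⊗ a1)) => x.
rewrite -hb sw_sw; last by lint.
by apply: eq_sw => a0 a1; rewrite tlift_pure //; lint.
Qed.
Definition homT_lift_fun (a : A) : homT_comod T X M := HomT (homT_lift_subproof a).
Lemma homT_lift_lin : lin homT_lift_fun.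
Proof. by move=> c x y; apply: val_inj; rewrite /= lb. Qed.
Lemma homT_lift_colin a :
  coact (homT_lift_fun a) = \sw_(a0, a1 <- coact a) (homT_lift_fun a0 ⊗ a1).
Proof.
apply: (canT_inj (@homT_lhom_lin _ _ _ _ _) (@homT_lhom_inj _ _ _ _ _)) => x.
rewrite [LHS]homT_comodE -[LHS]hb /canT sw_sw; last by lint.
by apply: eq_sw => a0 a1; rewrite tlift_pure //; lint.
Qed.
Definition homT_lift : chom A (homT_comod T X M) :=
  mkCHom homT_lift_lin homT_lift_colin.
End HomLift.

Section HomFunctor.
Variables (k : fieldType) (H : hopfAlgebra k) (T : twist H).

Section Post.
Variables (W A B : comod H) (phi : chom A B).
Lemma lcomp_lin (f : homT T W A) : lin (fun w => phi (f w)).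
Proof. by lint. Qed.
Lemma post_lin : lin (fun f : homT T W A => mkLHom (lcomp_lin f)).
Proof. by move=> a f g; apply: lhom_eq => w; rewrite /= linearP. Qed.
Lemma post_rho (f : homT_comod T W A) w :
  \sw_(g, h <- coact f) (mkLHom (lcomp_lin g) w ⊗ h) = rhoT T (mkLHom (lcomp_lin f)) w.
Proof.
have bT := tw_bilin T.
transitivity (\sw_(v, h <- rhoT T (f : homT T W A) w) (phi v ⊗ h)).
  rewrite -homT_comodE sw_sw; last by lint.
  by apply: eq_sw => g h; rewrite tlift_pure //; lint.
rewrite /rhoT sw_sw; last by lint.
apply: eq_sw => w0 w1; rewrite /= chom_colin !sw_sw; [|by lint|by lint].
by apply: eq_sw => v0 v1; rewrite !tlift_pure //; lint.
Qed.
Definition homT_post : chom (homT_comod T W A) (homT_comod T W B) :=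
  @homT_lift _ _ T W B (homT_comod T W A) _ post_lin post_rho.
Lemma homT_postE (f : homT T W A) w : (homT_post f : homT T W B) w = phi (f w).
Proof. by []. Qed.
End Post.

Section Pre.
Variables (W W' M : comod H) (psi : chom W W').
Lemma rcomp_lin (f : homT T W' M) : lin (fun w => f (psi w)).
Proof. by lint. Qed.
Lemma pre_lin : lin (fun f : homT T W' M => mkLHom (rcomp_lin f)).
Proof. by move=> a f g; apply: lhom_eq. Qed.
Lemma pre_rho (f : homT_comod T W' M) w :
  \sw_(g, h <- coact f) (mkLHom (rcomp_lin g) w ⊗ h) = rhoT T (mkLHom (rcomp_lin f)) w.
Proof.
have bT := tw_bilin T.
rewrite [LHS]homT_comodE /rhoT chom_colin sw_sw; last by lint.
by apply: eq_sw => w0 w1; rewrite tlift_pure //; lint.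
Qed.
Definition homT_pre : chom (homT_comod T W' M) (homT_comod T W M) :=
  @homT_lift _ _ T W M (homT_comod T W' M) _ pre_lin pre_rho.
Lemma homT_preE (f : homT T W' M) w : (homT_pre f : homT T W M) w = f (psi w).
Proof. by []. Qed.
End Pre.

End HomFunctor.

Section TensorMaps.
Variables (k : fieldType) (H : hopfAlgebra k).
Local Notation "A ⊠ B" := (tens_comod A B) (at level 39, left associativity).

Lemma chom_tens_ext (A B N : comod H) (f : A ⨂ B -> N) : lin f ->
  (forall a b, coact (f (a ⊗ b)) =
     \sw_(a0, a1 <- coact a) \sw_(b0, b1 <- coact b) (f (a0 ⊗ b0) ⊗ (a1 * b1))) ->
  forall t : A ⊠ B, coact (f t) = \sw_(m0, m1 <- coact t) (f m0 ⊗ m1).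
Proof.
move=> lf e; apply: (tens_ext (f := fun t => coact (f t))
   (g := fun t => \sw_(m0, m1 <- @coact _ _ (A ⊠ B) t) (f m0 ⊗ m1))); try by lint.
move=> a b; rewrite e tens_comodE sw_sw; last by lint.
apply: eq_sw => a0 a1; rewrite sw_sw; last by lint.
by apply: eq_sw => b0 b1; rewrite tlift_pure //; lint.
Qed.

Section Map.
Variables (V A B : comod H) (phi : chom A B).
Definition tens_map_fun (t : V ⨂ A) : V ⨂ B := \sw_(v, a <- t) (v ⊗ phi a).
Lemma tens_map_lin : lin tens_map_fun.
Proof. by rewrite /tens_map_fun; lint. Qed.
Lemma tens_map_pure v a : tens_map_fun (v ⊗ a) = v ⊗ phi a.
Proof. by rewrite /tens_map_fun tlift_pure //; lint. Qed.
Lemma tens_map_colin (t : V ⊠ A) :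
  @coact _ _ (V ⊠ B) (tens_map_fun t) = \sw_(m0, m1 <- coact t) (tens_map_fun m0 ⊗ m1).
Proof.
move: t; apply: (chom_tens_ext (N := V ⊠ B)); first exact: tens_map_lin.
move=> v a; rewrite tens_map_pure tens_comodE; apply: eq_sw => v0 v1.
rewrite chom_colin sw_sw; last by lint.
by apply: eq_sw => a0 a1; rewrite tlift_pure ?tens_map_pure //; lint.
Qed.
Definition tens_map : chom (V ⊠ A) (V ⊠ B) :=
  @mkCHom _ _ (V ⊠ A) (V ⊠ B) _ tens_map_lin tens_map_colin.
End Map.

Section Assoc.
Variables (A B C : comod H).
Definition tassoc_fun (t : (A ⨂ B) ⨂ C) : A ⨂ (B ⨂ C) :=
  \sw_(x, c <- t) \sw_(a, b <- x) (a ⊗ (b ⊗ c)).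
Lemma tassoc_lin : lin tassoc_fun.
Proof. by rewrite /tassoc_fun; lint. Qed.
Lemma tassoc_pure a b c : tassoc_fun ((a ⊗ b) ⊗ c) = a ⊗ (b ⊗ c).
Proof.
rewrite /tassoc_fun tlift_pure; last by lint.
by rewrite tlift_pure //; lint.
Qed.
Lemma tassoc_colin (t : A ⊠ B ⊠ C) : @coact _ _ (A ⊠ (B ⊠ C)) (tassoc_fun t)
  = \sw_(m0, m1 <- coact t) (tassoc_fun m0 ⊗ m1).
Proof.
have lt := tassoc_lin.
move: t; apply: (chom_tens_ext (N := A ⊠ (B ⊠ C))) => // x c.
apply: (tens_ext (f := fun x => @coact _ _ (A ⊠ (B ⊠ C)) (tassoc_fun (x ⊗ c)))
  (g := fun x => \sw_(a0, a1 <- @coact _ _ (A ⊠ B) x) \sw_(b0, b1 <- coact c)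
     (tassoc_fun (a0 ⊗ b0) ⊗ (a1 * b1)))); try by lint.
move=> a b; rewrite tassoc_pure !tens_comodE sw_sw; last by lint.
apply: eq_sw => a0 a1; rewrite sw_sw; last by lint.
rewrite sw_sw; last by lint.
apply: eq_sw => b0 b1; rewrite sw_sw; last by lint.
rewrite tlift_pure; last by lint.
apply: eq_sw => c0 c1; rewrite tlift_pure; last by lint.
by rewrite tassoc_pure mulrA.
Qed.
Definition tassoc : chom (A ⊠ B ⊠ C) (A ⊠ (B ⊠ C)) :=
  @mkCHom _ _ (A ⊠ B ⊠ C) (A ⊠ (B ⊠ C)) _ tassoc_lin tassoc_colin.

Definition tassocV_fun (t : A ⨂ (B ⨂ C)) : (A ⨂ B) ⨂ C :=
  \sw_(a, x <- t) \sw_(b, c <- x) ((a ⊗ b) ⊗ c).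
Lemma tassocV_lin : lin tassocV_fun.
Proof. by rewrite /tassocV_fun; lint. Qed.
Lemma tassocV_pure a b c : tassocV_fun (a ⊗ (b ⊗ c)) = (a ⊗ b) ⊗ c.
Proof.
rewrite /tassocV_fun tlift_pure; last by lint.
by rewrite tlift_pure //; lint.
Qed.
Lemma tassocV_colin (t : A ⊠ (B ⊠ C)) : @coact _ _ (A ⊠ B ⊠ C) (tassocV_fun t)
  = \sw_(m0, m1 <- coact t) (tassocV_fun m0 ⊗ m1).
Proof.
have lt := tassocV_lin.
move: t; apply: (chom_tens_ext (N := A ⊠ B ⊠ C)) => // a x.
apply: (tens_ext (f := fun x => @coact _ _ (A ⊠ B ⊠ C) (tassocV_fun (a ⊗ x)))
  (g := fun x => \sw_(a0, a1 <- coact a) \sw_(b0, b1 <- @coact _ _ (B ⊠ C) x)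
     (tassocV_fun (a0 ⊗ b0) ⊗ (a1 * b1)))); try by lint.
move=> b c; rewrite tassocV_pure !tens_comodE sw_sw; last by lint.
apply: eq_sw => a0 a1; rewrite !sw_sw; [|by lint|by lint].
apply: eq_sw => b0 b1; rewrite tlift_pure; last by lint.
rewrite sw_sw; last by lint.
apply: eq_sw => c0 c1; rewrite tlift_pure; last by lint.
by rewrite tassocV_pure mulrA.
Qed.
Definition tassocV : chom (A ⊠ (B ⊠ C)) (A ⊠ B ⊠ C) :=
  @mkCHom _ _ (A ⊠ (B ⊠ C)) (A ⊠ B ⊠ C) _ tassocV_lin tassocV_colin.
End Assoc.
End TensorMaps.

Section AntipodeInverse.
Variables (k : fieldType) (H : hopfAlgebra k).
Local Notation Δ := (@comul k H).
Local Notation ε := (@counit k H).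
Local Notation S := (@antipode k H).
Hypothesis bijS : bijective S.

Lemma antipodeV_ex : exists g : H -> H, cancel S g /\ cancel g S.
Proof. by case: bijS => g Sg gS; exists g. Qed.
Definition antipodeV : H -> H := sval (cid antipodeV_ex).
Local Notation S' := antipodeV.

Lemma antipodeK : cancel S S'.
Proof. by rewrite /antipodeV; case: cid => g []. Qed.
Lemma antipodeVK : cancel S' S.
Proof. by rewrite /antipodeV; case: cid => g []. Qed.
Lemma antipodeV_lin : lin S'.
Proof. by move=> a x y; apply: (can_inj antipodeK); rewrite linearP !antipodeVK. Qed.

Lemma antipodeV_comul h : Δ (S' h) = \sw_(h1, h2 <- Δ h) (S' h2 ⊗ S' h1).
Proof.
have l := antipodeV_lin; rewrite -[in RHS](antipodeVK h) antipode_comul sw_sw; last by lint.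
rewrite -[LHS]sw_id; apply: eq_sw => a b; rewrite tlift_pure; last by lint.
by rewrite !antipodeK.
Qed.
Lemma antipodeV_counit h : ε (S' h) = ε h.
Proof. by rewrite -[in RHS](antipodeVK h) antipode_counit. Qed.
Lemma antipodeVL h : \sw_(h1, h2 <- Δ h) (S' h2 * h1) = (ε h : k) *: 1.
Proof.
have l := antipodeV_lin; rewrite -(antipodeVK h) antipode_comul sw_sw; last by lint.
rewrite antipode_counit -antipodeR; apply: eq_sw => a b.
by rewrite tlift_pure; [rewrite antipodeK|lint].
Qed.
Lemma antipodeVR h : \sw_(h1, h2 <- Δ h) (h2 * S' h1) = (ε h : k) *: 1.
Proof.
have l := antipodeV_lin; rewrite -(antipodeVK h) antipode_comul sw_sw; last by lint.
rewrite antipode_counit -antipodeL; apply: eq_sw => a b.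
by rewrite tlift_pure; [rewrite antipodeK|lint].
Qed.

Definition twl_fun (v w : H) : H := v * S w.
Lemma twl_bilin : bilin twl_fun.
Proof. by rewrite /twl_fun; lint. Qed.
Lemma twl_comul a b : Δ (twl_fun a b) =
  \sw_(a1, a2 <- Δ a) \sw_(b1, b2 <- Δ b) (twl_fun a1 b2 ⊗ twl_fun a2 b1).
Proof.
rewrite comulM; apply: eq_sw => a1 a2; rewrite antipode_comul sw_sw; last by lint.
by apply: eq_sw => b1 b2; rewrite tlift_pure //; lint.
Qed.
Lemma twl_counit a b : ε (twl_fun a b) = (ε a : k) * ε b.
Proof. by rewrite counitM antipode_counit. Qed.
Definition twl : twist H := Twist twl_bilin twl_comul twl_counit.

Definition twr_fun (v w : H) : H := S' w * v.
Lemma twr_bilin : bilin twr_fun.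
Proof. by have l := antipodeV_lin; rewrite /twr_fun; lint. Qed.
Lemma twr_comul a b : Δ (twr_fun a b) =
  \sw_(a1, a2 <- Δ a) \sw_(b1, b2 <- Δ b) (twr_fun a1 b2 ⊗ twr_fun a2 b1).
Proof.
have l := antipodeV_lin.
rewrite comulM antipodeV_comul sw_sw; last by lint.
rewrite [RHS]sw_swap; apply: eq_sw => b1 b2.
by rewrite tlift_pure //; lint.
Qed.
Lemma twr_counit a b : ε (twr_fun a b) = (ε a : k) * ε b.
Proof. by rewrite counitM antipodeV_counit mulrC. Qed.
Definition twr : twist H := Twist twr_bilin twr_comul twr_counit.

Local Notation "A ⊠ B" := (tens_comod A B) (at level 39, left associativity).
Definition hom_l (W V : comod H) : comod H := homT_comod twl W V.
Definition hom_r (W V : comod H) : comod H := homT_comod twr W V.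

Section Adjunction.
Variables (W V : comod H).

Definition eval_l_fun (t : hom_l W V ⨂ W) : V := \sw_(f, w <- t) ((f : homT twl W V) w).
Lemma eval_l_lin : lin eval_l_fun.
Proof. by rewrite /eval_l_fun; lint. Qed.
Lemma eval_l_pure (f : homT twl W V) w : eval_l_fun ((f : hom_l W V) ⊗ w) = f w.
Proof. by rewrite /eval_l_fun tlift_pure //; lint. Qed.
Lemma eval_l_colin (t : hom_l W V ⊠ W) :
  coact (eval_l_fun t) = \sw_(m0, m1 <- coact t) (eval_l_fun m0 ⊗ m1).
Proof.
have ll := eval_l_lin.
move: t; apply: chom_tens_ext => // f w; rewrite eval_l_pure.
transitivity (\sw_(w0, w1 <- coact w)
   \sw_(v, h <- rhoT twl (f : homT twl W V) w0) (v ⊗ (h * w1))); last first.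
  rewrite sw_swap; apply: eq_sw => w0 w1; rewrite -homT_comodE sw_sw; last by lint.
  by apply: eq_sw => g h; rewrite tlift_pure ?eval_l_pure //; lint.
transitivity (\sw_(w0, w1 <- coact w) \sw_(x, y <- coact w0)
   \sw_(v0, v1 <- coact ((f : homT twl W V) x)) (v0 ⊗ (v1 * S y * w1))); last first.
  apply: eq_sw => w0 w1; rewrite /rhoT sw_sw; last by lint.
  apply: eq_sw => x y; rewrite sw_sw; last by lint.
  by apply: eq_sw => v0 v1; rewrite tlift_pure //; lint.
rewrite (coactE (T := fun x y w1 => \sw_(v0, v1 <- coact ((f : homT twl W V) x))
   (v0 ⊗ (v1 * S y * w1)))); last by split=> ? ?; lint.
rewrite -[LHS](coact_counitE (f := fun w => coact ((f : homT twl W V) w)) w); last by lint.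
apply: eq_sw => w0 w1; rewrite sw_swap -[in LHS](sw_id (coact _)).
rewrite scale_sw.
apply: eq_sw => v0 v1; under eq_sw => a b do rewrite -mulrA.
rewrite -(lin_sw _ _ ((tpure_bilin _ _).2 v0)).
rewrite -(mulr_sw (fun a b => S a * b)) antipodeL.
by rewrite -scalerAr mulr1 tpureZr.
Qed.
Definition eval_l : chom (hom_l W V ⊠ W) V :=
  @mkCHom _ _ (hom_l W V ⊠ W) V _ eval_l_lin eval_l_colin.

Definition eval_r_fun (t : W ⨂ hom_r W V) : V := \sw_(w, f <- t) ((f : homT twr W V) w).
Lemma eval_r_lin : lin eval_r_fun.
Proof. by rewrite /eval_r_fun; lint. Qed.
Lemma eval_r_pure w (f : homT twr W V) : eval_r_fun (w ⊗ (f : hom_r W V)) = f w.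
Proof. by rewrite /eval_r_fun tlift_pure //; lint. Qed.
Lemma eval_r_colin (t : W ⊠ hom_r W V) :
  coact (eval_r_fun t) = \sw_(m0, m1 <- coact t) (eval_r_fun m0 ⊗ m1).
Proof.
have ll := eval_r_lin; have lS := antipodeV_lin.
move: t; apply: chom_tens_ext => // w f; rewrite eval_r_pure.
transitivity (\sw_(w0, w1 <- coact w)
   \sw_(v, h <- rhoT twr (f : homT twr W V) w0) (v ⊗ (w1 * h))); last first.
  apply: eq_sw => w0 w1; rewrite -homT_comodE sw_sw; last by lint.
  by apply: eq_sw => g h; rewrite tlift_pure ?eval_r_pure //; lint.
transitivity (\sw_(w0, w1 <- coact w) \sw_(x, y <- coact w0)
   \sw_(v0, v1 <- coact ((f : homT twr W V) x)) (v0 ⊗ (w1 * S' y * v1))); last first.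
  apply: eq_sw => w0 w1; rewrite /rhoT sw_sw; last by lint.
  apply: eq_sw => x y; rewrite sw_sw; last by lint.
  by apply: eq_sw => v0 v1; rewrite tlift_pure -?mulrA //; lint.
rewrite (coactE (T := fun x y w1 => \sw_(v0, v1 <- coact ((f : homT twr W V) x))
   (v0 ⊗ (w1 * S' y * v1)))); last by split=> ? ?; lint.
rewrite -[LHS](coact_counitE (f := fun w => coact ((f : homT twr W V) w)) w); last by lint.
apply: eq_sw => w0 w1; rewrite sw_swap -[in LHS](sw_id (coact _)).
rewrite scale_sw.
apply: eq_sw => v0 v1.
rewrite -(lin_sw _ _ ((tpure_bilin _ _).2 v0)).
rewrite -(mull_sw (fun a b => b * S' a)) antipodeVR.
by rewrite -scalerAl mul1r tpureZr.
Qed.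
Definition eval_r : chom (W ⊠ hom_r W V) V :=
  @mkCHom _ _ (W ⊠ hom_r W V) V _ eval_r_lin eval_r_colin.

(* Hom(T (x) W, V)^H -> Hom(T, Hom^l(W, V))^H, t |-> (w |-> b (t (x) w)) *)
Section Left.
Variables (T : comod H) (b : chom (T ⊠ W) V).
Lemma adj_l_sub t : lin (fun w : W => b (t ⊗ w)).
Proof. by lint. Qed.
Lemma adj_l_lin : lin (fun t : T => mkLHom (adj_l_sub t)).
Proof.
by move=> a x y; apply: lhom_eq => w /=; rewrite tpureDl tpureZl linearP.
Qed.
Lemma adj_l_rho t w : \sw_(t0, t1 <- coact t) (mkLHom (adj_l_sub t0) w ⊗ t1)
  = rhoT twl (mkLHom (adj_l_sub t)) w.
Proof.
rewrite /rhoT /=.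
transitivity (\sw_(w0, w1 <- coact w) \sw_(x, y <- coact w0)
   \sw_(t0, t1 <- coact t) (b (t0 ⊗ x) ⊗ (t1 * y * S w1))); last first.
  apply: eq_sw => w0 w1; rewrite (chom_colin b) sw_sw; last by rewrite /twl_fun; lint.
  rewrite tens_comodE sw_sw; last by rewrite /twl_fun; lint.
  rewrite sw_swap; apply: eq_sw => t0 t1.
  rewrite sw_sw; last by rewrite /twl_fun; lint.
  apply: eq_sw => x y; rewrite tlift_pure; last by rewrite /twl_fun; lint.
  by rewrite tlift_pure //; rewrite /twl_fun; lint.
rewrite (coactE (T := fun x y w1 => \sw_(t0, t1 <- coact t)
  (b (t0 ⊗ x) ⊗ (t1 * y * S w1)))); last by split=> ? ?; lint.
rewrite -[LHS](coact_counitE (f := fun w =>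
  \sw_(t0, t1 <- coact t) (b (t0 ⊗ w) ⊗ t1)) w); last by lint.
apply: eq_sw => w0 w1; rewrite sw_swap.
rewrite scale_sw.
apply: eq_sw => t0 t1; under eq_sw => x y do rewrite -mulrA.
rewrite -(lin_sw _ _ ((tpure_bilin _ _).2 _)).
rewrite -(mulr_sw (fun a b => a * S b)) antipodeR.
by rewrite -scalerAr mulr1 tpureZr.
Qed.
Definition adj_l : chom T (hom_l W V) := homT_lift adj_l_lin adj_l_rho.
End Left.

(* Hom(W (x) T, V)^H -> Hom(T, Hom^r(W, V))^H, t |-> (w |-> b (w (x) t)) *)
Section Right.
Variables (T : comod H) (b : chom (W ⊠ T) V).
Lemma adj_r_sub t : lin (fun w : W => b (w ⊗ t)).
Proof. by lint. Qed.
Lemma adj_r_lin : lin (fun t : T => mkLHom (adj_r_sub t)).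
Proof.
by move=> a x y; apply: lhom_eq => w /=; rewrite tpureDr tpureZr linearP.
Qed.
Lemma adj_r_rho t w : \sw_(t0, t1 <- coact t) (mkLHom (adj_r_sub t0) w ⊗ t1)
  = rhoT twr (mkLHom (adj_r_sub t)) w.
Proof.
have lS := antipodeV_lin.
rewrite /rhoT /=.
transitivity (\sw_(w0, w1 <- coact w) \sw_(x, y <- coact w0)
   \sw_(t0, t1 <- coact t) (b (x ⊗ t0) ⊗ (S' w1 * y * t1))); last first.
  apply: eq_sw => w0 w1; rewrite (chom_colin b) sw_sw; last by rewrite /twr_fun; lint.
  rewrite tens_comodE sw_sw; last by rewrite /twr_fun; lint.
  apply: eq_sw => x y.
  rewrite sw_sw; last by rewrite /twr_fun; lint.
  apply: eq_sw => t0 t1; rewrite tlift_pure; last by rewrite /twr_fun; lint.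
  by rewrite tlift_pure /twr_fun -?mulrA //; lint.
rewrite (coactE (T := fun x y w1 => \sw_(t0, t1 <- coact t)
  (b (x ⊗ t0) ⊗ (S' w1 * y * t1)))); last by split=> ? ?; lint.
rewrite -[LHS](coact_counitE (f := fun w =>
  \sw_(t0, t1 <- coact t) (b (w ⊗ t0) ⊗ t1)) w); last by lint.
apply: eq_sw => w0 w1; rewrite sw_swap.
rewrite scale_sw.
apply: eq_sw => t0 t1.
rewrite -(lin_sw _ _ ((tpure_bilin _ _).2 _)).
rewrite -(mull_sw (fun a b => S' b * a)) antipodeVL.
by rewrite -scalerAl mul1r tpureZr.
Qed.
Definition adj_r : chom T (hom_r W V) := homT_lift adj_r_lin adj_r_rho.
End Right.
End Adjunction.

Section Currying.
Variables (W V M : comod H).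

(* The associativity identifications are the adjuncts of iterated evaluations;  *)
(* [curry_lE], [curry_rE] and [exchE] give their values.                        *)

Definition curry_l : chom (hom_l (W ⊠ V) M) (hom_l W (hom_l V M)) :=
  adj_l (adj_l (chom_comp (eval_l (W ⊠ V) M) (tassoc (hom_l (W ⊠ V) M) W V))).

Definition curry_r : chom (hom_r (W ⊠ V) M) (hom_r V (hom_r W M)) :=
  adj_r (adj_r (chom_comp (eval_r (W ⊠ V) M) (tassocV W V (hom_r (W ⊠ V) M)))).

Definition exch : chom (hom_l W (hom_r V M)) (hom_r V (hom_l W M)) :=
  adj_r (adj_l (chom_comp (eval_r V M)
    (chom_comp (tens_map V (eval_l W (hom_r V M))) (tassoc V (hom_l W (hom_r V M)) W)))).

Lemma curry_lE (f : homT twl (W ⊠ V) M) w v :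
  ((curry_l f : homT twl W (hom_l V M)) w : homT twl V M) v = f (w ⊗ v).
Proof. by rewrite /= tassoc_pure eval_l_pure. Qed.

Lemma curry_rE (f : homT twr (W ⊠ V) M) w v :
  ((curry_r f : homT twr V (hom_r W M)) v : homT twr W M) w = f (w ⊗ v).
Proof. by rewrite /= tassocV_pure eval_r_pure. Qed.

Lemma exchE (f : homT twl W (hom_r V M)) w v :
  ((exch f : homT twr V (hom_l W M)) v : homT twl W M) w = (f w : homT twr V M) v.
Proof. by rewrite /= tassoc_pure tens_map_pure /= eval_l_pure eval_r_pure. Qed.

End Currying.
End AntipodeInverse.

Record category := Category {
  obj :> Type;
  mor : obj -> obj -> Type;
  idm : forall x, mor x x;
  cmp : forall x y z, mor y z -> mor x y -> mor x z;
  cmp_idl : forall x y (f : mor x y), cmp (idm y) f = f;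
  cmp_idr : forall x y (f : mor x y), cmp f (idm x) = f;
  cmpA : forall x y z t (h : mor z t) (g : mor y z) (f : mor x y),
    cmp h (cmp g f) = cmp (cmp h g) f
}.
Arguments idm {c} x.
Arguments cmp {c x y z} g f.

Record functor (C D : category) := Functor {
  fobj :> C -> D;
  fmap : forall x y, mor x y -> mor (fobj x) (fobj y);
  fmap_id : forall x, fmap (idm x) = idm (fobj x);
  fmap_cmp : forall x y z (g : mor y z) (f : mor x y),
    fmap (cmp g f) = cmp (fmap g) (fmap f)
}.
Arguments fmap {C D} _ [x y] _.

Definition functor_id (C : category) : functor C C :=
  @Functor C C id (fun x y f => f) (fun=> erefl) (fun _ _ _ _ _ => erefl).

Section FunctorComp.
Variables (C D E : category) (G : functor D E) (F : functor C D).
Lemma functor_comp_id (x : C) : fmap G (fmap F (idm x)) = idm (G (F x)).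
Proof. by rewrite !fmap_id. Qed.
Lemma functor_comp_cmp (x y z : C) (g : mor y z) (f : mor x y) :
  fmap G (fmap F (cmp g f)) = cmp (fmap G (fmap F g)) (fmap G (fmap F f)).
Proof. by rewrite !fmap_cmp. Qed.
Definition functor_comp : functor C E :=
  @Functor C E (fun x => G (F x)) (fun x y f => fmap G (fmap F f))
    functor_comp_id functor_comp_cmp.
End FunctorComp.

Definition is_iso (C : category) (x y : C) (f : mor x y) :=
  exists g : mor y x, cmp g f = idm x /\ cmp f g = idm y.

Definition nat_iso (C D : category) (F G : functor C D) :=
  exists eta : forall x, mor (F x) (G x),
    (forall x, is_iso (eta x)) /\
    forall x y (f : mor x y), cmp (eta y) (fmap F f) = cmp (fmap G f) (eta x).

Definition equivalent (C D : category) :=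
  exists (F : functor C D) (G : functor D C),
    nat_iso (functor_comp G F) (functor_id C) /\
    nat_iso (functor_comp F G) (functor_id D).

Section AntiYetterDrinfeld.
Variables (k : fieldType) (H : hopfAlgebra k).

Record aYD := AYD {
  ayd_comod :> comod H;
  ayd_act : H -> ayd_comod -> ayd_comod;
  ayd_act_bilin : bilin ayd_act;
  ayd_act1 : forall m, ayd_act 1 m = m;
  ayd_actM : forall g h m, ayd_act (g * h) m = ayd_act g (ayd_act h m);
  (* h1, h2, h3 come from (Δ (x) 1) (Δ h) *)
  ayd_coact : forall h m, coact (ayd_act h m) =
    \sw_(x, h3 <- comul h) \sw_(h1, h2 <- comul x) \sw_(m0, m1 <- coact m)
      (ayd_act h2 m0 ⊗ (h3 * m1 * antipode h1))
}.

Record aYD_hom (M N : aYD) := AYDHom {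
  ayd_chom :> chom M N;
  ayd_hom_act : forall h m, ayd_chom (ayd_act h m) = ayd_act h (ayd_chom m)
}.

Lemma aYD_hom_eq (M N : aYD) (f g : aYD_hom M N) : f =1 g -> f = g.
Proof.
case: f g => [f hf] [g hg] /= e; have fg : f = g by apply: chom_eq.
by rewrite -fg in hg *; rewrite (Prop_irrelevance hf hg).
Qed.

Definition aYD_id (M : aYD) : aYD_hom M M := @AYDHom M M (chom_id M) (fun _ _ => erefl).

Lemma aYD_comp_act (M N P : aYD) (g : aYD_hom N P) (f : aYD_hom M N) h m :
  chom_comp g f (ayd_act h m) = ayd_act h (chom_comp g f m).
Proof. by rewrite /= !ayd_hom_act. Qed.
Definition aYD_comp (M N P : aYD) (g : aYD_hom N P) (f : aYD_hom M N) : aYD_hom M P :=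
  AYDHom (aYD_comp_act g f).

Lemma aYD_idl M N (f : aYD_hom M N) : aYD_comp (aYD_id N) f = f.
Proof. exact: aYD_hom_eq. Qed.
Lemma aYD_idr M N (f : aYD_hom M N) : aYD_comp f (aYD_id M) = f.
Proof. exact: aYD_hom_eq. Qed.
Lemma aYD_compA M N P Q (h : aYD_hom P Q) (g : aYD_hom N P) (f : aYD_hom M N) :
  aYD_comp h (aYD_comp g f) = aYD_comp (aYD_comp h g) f.
Proof. exact: aYD_hom_eq. Qed.

Definition aYD_category : category := Category aYD_idl aYD_idr aYD_compA.

End AntiYetterDrinfeld.

Section Center.
Variables (k : fieldType) (H : hopfAlgebra k) (bijS : bijective (@antipode k H)).
Local Notation "A ⊠ B" := (tens_comod A B) (at level 39, left associativity).
Local Notation "W ▷ M" := (hom_l W M) (at level 40).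
Local Notation "M ◁ W" := (hom_r bijS W M) (at level 40).

(* [center_unit] uses the identifications f |-> f 1 of k ▷ M and M ◁ k with M.   *)
Record center := Center {
  center_comod :> comod H;
  center_tau : forall W, chom (W ▷ center_comod) (center_comod ◁ W);
  center_iso : forall W, chom_iso (center_tau W);
  center_nat : forall (W W' : comod H) (f : chom W W'),
    chom_comp (center_tau W) (homT_pre (twl H) center_comod f)
    = chom_comp (homT_pre (twr bijS) center_comod f) (center_tau W');
  center_unit : forall f : homT (twl H) (unit_comod H) center_comod,
    (center_tau (unit_comod H) f : homT (twr bijS) _ _) 1 = f 1;
  center_tens : forall W V : comod H,
    chom_comp (curry_r bijS W V center_comod) (center_tau (W ⊠ V))
    = chom_comp (homT_post (twr bijS) V (center_tau W))
        (chom_comp (exch bijS W V center_comod)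
           (chom_comp (homT_post (twl H) W (center_tau V))
              (curry_l W V center_comod)))
}.

Record center_hom (M N : center) := CenterHom {
  center_chom :> chom M N;
  center_hom_tau : forall W,
    chom_comp (homT_post (twr bijS) W center_chom) (center_tau M W)
    = chom_comp (center_tau N W) (homT_post (twl H) W center_chom)
}.

Lemma center_hom_eq (M N : center) (f g : center_hom M N) : f =1 g -> f = g.
Proof.
case: f g => [f hf] [g hg] /= e; have fg : f = g by apply: chom_eq.
by rewrite -fg in hg *; rewrite (Prop_irrelevance hf hg).
Qed.

Lemma center_id_tau (M : center) W :
  chom_comp (homT_post (twr bijS) W (chom_id M)) (center_tau M W)
  = chom_comp (center_tau M W) (homT_post (twl H) W (chom_id M)).
Proof.
have e T : homT_post T W (chom_id M) = chom_id _.
  by apply: chom_eq => f; apply: homT_eq.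
by rewrite !e; apply: chom_eq.
Qed.
Definition center_id (M : center) : center_hom M M := CenterHom (center_id_tau M).

Lemma center_comp_tau (M N P : center) (g : center_hom N P) (f : center_hom M N) W :
  chom_comp (homT_post (twr bijS) W (chom_comp g f)) (center_tau M W)
  = chom_comp (center_tau P W) (homT_post (twl H) W (chom_comp g f)).
Proof.
have e T : homT_post T W (chom_comp g f)
    = chom_comp (homT_post T W g) (homT_post T W f).
  by apply: chom_eq => x; apply: homT_eq.
by rewrite !e -chom_compA center_hom_tau chom_compA center_hom_tau -chom_compA.
Qed.
Definition center_comp (M N P : center) (g : center_hom N P) (f : center_hom M N) :
  center_hom M P := CenterHom (center_comp_tau g f).

Lemma center_idl M N (f : center_hom M N) : center_comp (center_id N) f = f.
Proof. exact: center_hom_eq. Qed.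
Lemma center_idr M N (f : center_hom M N) : center_comp f (center_id M) = f.
Proof. exact: center_hom_eq. Qed.
Lemma center_compA M N P Q (h : center_hom P Q) (g : center_hom N P) (f : center_hom M N) :
  center_comp h (center_comp g f) = center_comp (center_comp h g) f.
Proof. exact: center_hom_eq. Qed.

Definition center_category : category := Category center_idl center_idr center_compA.

End Center.

(* Main.v *)
Require Import Defs.
From HB Require Import structures.
From mathcomp Require Import all_boot all_order all_algebra.
From mathcomp Require Import boolp classical_sets functions.

Set Implicit Arguments.
Unset Strict Implicit.
Unset Printing Implicit Defensive.

Import GRing.Theory.
Local Open Scope ring_scope.

(** An anti-Yetter-Drinfeld module M carries the central structure
    tau_W f (w) = w_1 . f(w_0), with inverse g |-> (w |-> S^-1(w_1) . g(w_0)).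
    Transposed along the adjunctions these are maps W (x) Hom^l(W, M) -> M and
    Hom^r(W, M) (x) W -> M, whose colinearity is exactly the aYD condition.

    Conversely, an action is recovered from tau by h . m = tau_W (eps(-) m) (h).
    The map eps(-) m on W = H is in general not in Hom^l(H, M), so W is taken to be
    the finite dimensional subcomodule of H generated by h; by naturality any
    finite dimensional W with a comodule map to H hitting h gives the same value.
    Reducing to finite dimensional subcomodules and to rank one maps
    f = xi(-) m, where w |-> xi(w_0) w_1 is a comodule map W -> H, one gets
    tau_W f (w) = w_1 . f(w_0) for every comodule W. Hence both composites of the
    two constructions are the identity, up to identity maps of comodules. *)

(** * Finite dual bases of subspaces and of tensor products *)

Section FiniteDimension.
Variable k : fieldType.
Implicit Types V W : lmodType k.

Lemma lin_rank1 V W (phi : V -> k^o) (w : W) :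
  lin phi -> lin (fun v => (phi v : k) *: w).
Proof. by move=> lphi; lint. Qed.
Definition rank1 V W (phi : lhom V k^o) (w : W) : lhom V W :=
  mkLHom (lin_rank1 w (lhomP phi)).

Lemma rank1_lin V W (phi : lhom V k^o) : lin (@rank1 V W phi).
Proof.
move=> a u v; apply: lhom_eq => w.
by rewrite /= scalerDr scalerA mulrC -scalerA.
Qed.

(* The vectors of this dual basis need not be independent. *)
Definition fdim V :=
  exists s : seq (V * lhom V k^o), forall v, v = \sum_(p <- s) (p.2 v : k) *: p.1.

Lemma lspan_mem V (s : seq V) x : x \in s -> lspan s x.
Proof.
elim: s => // y s IHs; rewrite inE => /predU1P [->|/IHs]; first exact: lspan_head.
exact: lspan_tail.
Qed.

(** Induction on [s]: either [P] lies in the span of the tail, or a functional vanishing on the tail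
    and equal to 1 at some [x0] of [P] splits off the line of [x0]. *)
Lemma lspan_dual_basis V (P : V -> Prop) (s : seq V) : subspace P ->
  (forall x, P x -> lspan s x) ->
  exists t : seq (V * lhom V k^o), (forall p, p \in t -> P p.1) /\
    forall x, P x -> x = \sum_(p <- t) (p.2 x : k) *: p.1.
Proof.
elim: s P => [|v s IHs] P sP Ps.
  by exists [::]; split=> // x /Ps /= ->; rewrite big_nil.
pose Q x := P x /\ lspan s x.
have ss := lspan_subspace s.
have sQ : subspace Q.
  by split=> [|a x y [Px sx] [Py sy]]; split; by [apply: sP.1|apply: ss.1|apply: sP.2|apply: ss.2].
have [t [tQ tE]] := IHs Q sQ (fun _ => @proj2 _ _).
have [[x0 [Px0 nx0]]|nx] := pselect (exists x, P x /\ ~ lspan s x); last first.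
  exists t; split=> [p /tQ [] //|x Px].
  by apply: tE; split=> //; apply: contrapT => nsx; apply: nx; exists x.
have [phi [lphi phi0 phis]] := sep_functional ss nx0.
have [a0 sa0] := Ps _ Px0.
have a0N : a0 != 0.
  by apply/eqP => a00; apply: nx0; move: sa0; rewrite a00 scale0r subr0.
have xQ x : P x -> Q (x - (phi x : k) *: x0).
  move=> Px; split; first by apply: subsp_sub => //; apply: subsp_scale.
  have [a sa] := Ps _ Px.
  (* The factor [a / a0] cancels the component along [v]; applying [phi] identifies it with
     [phi x]. *)
  have sx : lspan s (x - (a / a0) *: x0).
    have -> : x - (a / a0) *: x0 = (x - a *: v) - (a / a0) *: (x0 - a0 *: v).
      by rewrite scalerBr scalerA divfK // opprB addrA subrK.
    by apply: subsp_sub => //; apply: subsp_scale.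
  have := phis _ sx; rewrite (lin_add _ _ lphi) (lin_opp _ lphi) (lin_scale _ _ lphi) phi0.
  by move/eqP; rewrite subr_eq0 [_ *: 1]mulr1 => /eqP ->.
have lred (f : lhom V k^o) : lin (fun x => f (x - (phi x : k) *: x0)).
  move=> a x y; rewrite lphi -lhomP; congr (f _).
  by rewrite scalerBr scalerDl scalerA opprD addrACA.
exists ((x0, mkLHom lphi) :: [seq (p.1, mkLHom (lred p.2)) | p <- t]); split.
  by move=> p; rewrite inE => /predU1P [-> //|/mapP [q /tQ [Pq _] ->]].
move=> x Px; rewrite big_cons big_map /= -tE; last exact: xQ.
by rewrite addrC subrK.
Qed.

Lemma fdim_unit : fdim (k^o : lmodType k).
Proof.
exists [:: (1, mkLHom (@lin_id k k^o))] => v.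
by rewrite big_seq1 /= [RHS]mulr1.
Qed.

Lemma fdim_tens V W : fdim V -> fdim W -> fdim (V ⨂ W).
Proof.
move=> [s sE] [t tE].
have ll (f : lhom V k^o) (g : lhom W k^o) :
    lin (fun x : V ⨂ W => \sw_(v, w <- x) ((f v : k) *: g w)).
  by lint.
exists [seq (p.1 ⊗ q.1, mkLHom (ll p.2 q.2)) | p <- s, q <- t].
have l0 : lin (fun x : V ⨂ W => \sum_(p <- [seq (p.1 ⊗ q.1, mkLHom (ll p.2 q.2))
    | p <- s, q <- t]) (p.2 x : k) *: p.1).
  move=> a x y; rewrite scaler_sumr -big_split; apply: eq_bigr => p _ /=.
  by rewrite lhomP scalerDl scalerA.
apply: (tens_ext (f := id) _ l0) => // v w.
rewrite big_allpairs_dep /= [in LHS](sE v) (lin_suml _ _ ((tpure_bilin _ _).1 w)).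
apply: eq_bigr => p _; rewrite [in LHS](tE w) (lin_suml _ _ ((tpure_bilin _ _).2 _)).
apply: eq_bigr => q _; rewrite tlift_pure; last by lint.
by rewrite tpureZl tpureZr scalerA.
Qed.

End FiniteDimension.

(** * Subcomodules cut out by a subspace stable under slices of the coaction *)

Section Subcomodule.
Variables (k : fieldType) (H : hopfAlgebra k) (N : comod H) (P : submodClosed N).

Record sub_car := SubCar { sub_val : N; sub_valP : sub_val \in P }.
HB.instance Definition _ := [isSub for sub_val].
HB.instance Definition _ := [Choice of sub_car by <:].
HB.instance Definition _ := [SubChoice_isSubLmodule of sub_car by <:].

Lemma sub_val_lin : lin sub_val. Proof. by []. Qed.
Lemma sub_val_inj : injective sub_val. Proof. exact: val_inj. Qed.

Definition sub_tens (t : sub_car ⨂ H) : N ⨂ H := \sw_(u, h <- t) (sub_val u ⊗ h).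

Lemma sub_tens_lin : lin sub_tens.
Proof. by have l := sub_val_lin; rewrite /sub_tens; lint. Qed.
Lemma sub_tens_pure u h : sub_tens (u ⊗ h) = sub_val u ⊗ h.
Proof. by have l := sub_val_lin; rewrite /sub_tens tlift_pure //; lint. Qed.
Lemma slice_sub_tens phi t : lin phi -> slice phi (sub_tens t) = sub_val (slice phi t).
Proof.
move=> lphi; rewrite /sub_tens (lin_sw _ _ (slice_lin lphi)).
rewrite {2}/slice (lin_sw _ _ sub_val_lin).
by apply: eq_sw => u h; rewrite slice_pure.
Qed.
(** Slices separate tensors and commute with the inclusion, so injectivity survives tensoring with
    [H]. *)
Lemma sub_tens_inj : injective sub_tens.
Proof.
move=> t t' e; apply: slice_inj => phi lphi; apply: sub_val_inj.
by rewrite -!slice_sub_tens // e.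
Qed.

Lemma sub_seq_lift (A : eqType) (s : seq (N * A)) : (forall p, p \in s -> p.1 \in P) ->
  exists s' : seq (sub_car * A), s = [seq (sub_val p.1, p.2) | p <- s'].
Proof.
elim: s => [|p s IHs] sP; first by exists [::].
have [|s' ->] := IHs; first by move=> q qs; apply: sP; rewrite inE qs orbT.
by exists ((SubCar (sP p (mem_head _ _)), p.2) :: s'); case: p sP.
Qed.

Lemma sub_subspace : subspace (fun x : N => x \in P).
Proof.
by split=> [|a x y xP yP]; [apply: rpred0 | apply: rpredD => //; apply: rpredZ].
Qed.

Lemma sub_fdim (s : seq N) : (forall x, x \in P -> lspan s x) -> fdim sub_car.
Proof.
move=> /(lspan_dual_basis sub_subspace) [t [tP]].
have [t' ->] := sub_seq_lift tP => tE.
have l (f : lhom N k^o) : lin (fun u : sub_car => f (sub_val u)).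
  by have l := sub_val_lin; lint.
exists [seq (p.1, mkLHom (l p.2)) | p <- t'] => u; apply: sub_val_inj.
rewrite (lin_suml _ _ sub_val_lin) [LHS]tE ?sub_valP // !big_map.
by apply: eq_bigr => p _; rewrite (lin_scale _ _ sub_val_lin).
Qed.

Hypothesis P_stable : forall phi x, lin phi -> x \in P -> slice phi (coact x) \in P.

(** A tensor whose slices all lie in [P] has a representative with first legs in [P]. *)
Lemma sub_coact_ex u : exists t, sub_tens t = coact (sub_val u).
Proof.
have [s [sP ->]] :=
  slice_subspace sub_subspace (fun phi lphi => P_stable lphi (sub_valP u)).
have [s' ->] := sub_seq_lift sP.
exists (\sum_(p <- s') p.1 ⊗ p.2); rewrite big_map (lin_suml _ _ sub_tens_lin).
by apply: eq_bigr => p _; rewrite sub_tens_pure.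
Qed.

Definition sub_coact_fun u : sub_car ⨂ H := sval (cid (sub_coact_ex u)).
Lemma sub_coact_val u : sub_tens (sub_coact_fun u) = coact (sub_val u).
Proof. by rewrite /sub_coact_fun; case: cid. Qed.

Lemma sub_coact_lin : lin sub_coact_fun.
Proof.
by move=> a x y; apply: sub_tens_inj; rewrite sub_tens_lin !sub_coact_val linearP.
Qed.

Lemma sub_sw (U : lmodType k) (B : N -> H -> U) u : bilin B ->
  \sw_(x, h <- sub_coact_fun u) B (sub_val x) h = \sw_(n, h <- coact (sub_val u)) B n h.
Proof.
move=> bB; rewrite -sub_coact_val /sub_tens sw_sw //.
by apply: eq_sw => x h; rewrite tlift_pure.
Qed.

Lemma sub_coactA u :
  \sw_(m0, m1 <- sub_coact_fun u) \sw_(a, b <- sub_coact_fun m0) ((a ⊗ b) ⊗ m1)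
  = \sw_(m0, m1 <- sub_coact_fun u) \sw_(a, b <- comul m1) ((m0 ⊗ a) ⊗ b).
Proof.
have l1 := sub_tens_lin.
(* The identity is pushed along this injection, where it becomes [coactA] of [N]. *)
pose F (x : (sub_car ⨂ H) ⨂ H) := \sw_(y, h <- x) (sub_tens y ⊗ h).
have lF : lin F by rewrite /F; lint.
have Fp y h : F (y ⊗ h) = sub_tens y ⊗ h by rewrite /F tlift_pure //; lint.
have iF : injective F.
  move=> x y e; apply: slice_inj => phi lphi; apply: sub_tens_inj.
  have sE z : sub_tens (slice phi z) = slice phi (F z).
    rewrite /F (lin_sw _ _ (slice_lin lphi)) {1}/slice (lin_sw _ _ l1).
    by apply: eq_sw => g h; rewrite (lin_scale _ _ l1) slice_pure.
  by rewrite !sE e.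
apply: iF; rewrite !(lin_sw _ _ lF).
transitivity (\sw_(n, h <- coact (sub_val u)) \sw_(a, b <- coact n) ((a ⊗ b) ⊗ h)).
  rewrite -sub_sw; last by lint.
  apply: eq_sw => x h; rewrite (lin_sw _ _ lF) -sub_sw; last by lint.
  by apply: eq_sw => a b; rewrite Fp sub_tens_pure.
rewrite coactA -sub_sw; last by lint.
apply: eq_sw => x h; rewrite (lin_sw _ _ lF).
by apply: eq_sw => a b; rewrite Fp sub_tens_pure.
Qed.

Lemma sub_coact_counit u :
  \sw_(m0, m1 <- sub_coact_fun u) ((counit m1 : k) *: m0) = u.
Proof.
apply: sub_val_inj; rewrite (lin_sw _ _ sub_val_lin).
rewrite (sub_sw (B := fun n h => (counit h : k) *: n)); last by lint.
exact: coact_counit.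
Qed.

Definition sub_comod : comod H :=
  @Comod k H sub_car (mkLinear sub_coact_lin) sub_coactA sub_coact_counit.

Lemma sub_val_colin (u : sub_comod) :
  coact (sub_val u) = \sw_(u0, u1 <- coact u) (sub_val u0 ⊗ u1).
Proof. by rewrite -sub_coact_val. Qed.
Definition sub_incl : chom sub_comod N :=
  @mkCHom _ _ sub_comod N _ sub_val_lin sub_val_colin.

Section Corestriction.
Variables (X : comod H) (g : chom X N) (gP : forall x, g x \in P).
Definition corestr_fun x : sub_comod := SubCar (gP x).
Lemma corestr_lin : lin corestr_fun.
Proof. by move=> a x y; apply: sub_val_inj; rewrite /= linearP. Qed.
Lemma corestr_colin x :
  coact (corestr_fun x) = \sw_(x0, x1 <- coact x) (corestr_fun x0 ⊗ x1).
Proof.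
apply: sub_tens_inj; rewrite [LHS]sub_coact_val /= chom_colin.
rewrite (lin_sw _ _ sub_tens_lin).
by apply: eq_sw => x0 x1; rewrite sub_tens_pure.
Qed.
Definition corestr : chom X sub_comod := mkCHom corestr_lin corestr_colin.
End Corestriction.

End Subcomodule.

(** * The finite dimensional subcomodule generated by two vectors *)

Section Generated.
Variables (k : fieldType) (H : hopfAlgebra k).

(** Coassociativity makes slicing an action of the convolution algebra of functionals on [H], so the
    slices of one vector are stable under slicing. *)
Lemma slice_conv (N : comod H) (n : N) (phi psi : H -> k^o) : lin phi -> lin psi ->
  slice psi (coact (slice phi (coact n)))
  = slice (fun h => \sw_(a, b <- comul h) ((psi a : k) *: phi b)) (coact n).
Proof.
move=> lphi lpsi; rewrite /slice (lin_sw _ _ (linE coact)) sw_sw; last by lint.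
transitivity (\sw_(m0, m1 <- coact n) \sw_(a, b <- coact m0)
    (((psi b : k) * phi m1) *: a)).
  apply: eq_sw => m0 m1; rewrite linearZ /= (lin_scale _ _ (tlift_lin _)); last by lint.
  by rewrite scale_sw; apply: eq_sw => a b; rewrite scalerA mulrC.
rewrite (coactE (T := fun a b c => ((psi b : k) * phi c) *: a)).
  apply: eq_sw => m0 m1.
  by rewrite (lin_sw _ _ (@lin_scaleL _ _ _ id m0 (@lin_id _ _))).
split=> ? ?; lint.
Qed.

(* Membership in the subcomodule generated by x and y. Two generators are needed *)
(* because additivity of the action compares x, y and x + y in one comodule.     *)
Definition gen_pred (N : comod H) (x y : N) : {pred N} := fun z =>
  `[< exists phi psi : lhom H k^o, z = slice phi (coact x) + slice psi (coact y) >].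

Variables (N : comod H) (x y : N).

Lemma gen_submod : submod_closed (gen_pred x y).
Proof.
have sl (n : N) : lin (fun phi : lhom H k^o => slice phi (coact n)).
  by rewrite /slice; lint.
split.
  apply/asboolP; exists 0, 0; rewrite (lin_0 (sl x)) (lin_0 (sl y)) addr0 //.
move=> a u v /asboolP [p [q ->]] /asboolP [r [s ->]]; apply/asboolP.
exists (a *: p + r), (a *: q + s).
by rewrite (sl x) (sl y) scalerDr addrACA.
Qed.
HB.instance Definition _ :=
  GRing.isSubmodClosed.Build k N (gen_pred x y) gen_submod.

Lemma gen_stable phi z : lin phi -> z \in gen_pred x y ->
  slice phi (coact z) \in gen_pred x y.
Proof.
move=> lphi /asboolP [p [q ->]]; apply/asboolP.
have lc (f : lhom H k^o) : lin (fun h => \sw_(a, b <- comul h) ((phi a : k) *: f b)).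
  by lint.
exists (mkLHom (lc p)), (mkLHom (lc q)).
rewrite linearD (lin_add _ _ (slice_lin lphi)).
by rewrite !slice_conv //; apply: lhomP.
Qed.

Definition gen_comod : comod H := sub_comod gen_stable.

Lemma gen_memL : x \in gen_pred x y.
Proof.
apply/asboolP; exists (mkLHom (linE counit)), 0.
rewrite [X in X + _]coact_counit [X in _ + X](_ : _ = 0) ?addr0 //.
by rewrite /slice /tlift big1 // => p _; rewrite scale0r.
Qed.
Lemma gen_memR : y \in gen_pred x y.
Proof.
apply/asboolP; exists 0, (mkLHom (linE counit)).
rewrite [X in _ + X]coact_counit [X in X + _](_ : _ = 0) ?add0r //.
by rewrite /slice /tlift big1 // => p _; rewrite scale0r.
Qed.

Definition genL : gen_comod := SubCar gen_memL.
Definition genR : gen_comod := SubCar gen_memR.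

(** Local finiteness of comodules: the first legs of fixed representatives of [coact x] and
    [coact y] span all slices. *)
Lemma gen_fdim : fdim gen_comod.
Proof.
pose s (n : N) := map fst (repr (coact n)).
apply: (@sub_fdim _ _ _ _ (s x ++ s y)) => z /asboolP [phi [psi ->]].
have [l0 lD] := lspan_subspace (s x ++ s y).
have lsl (f : H -> k^o) (n : N) : {subset s n <= s x ++ s y} ->
    lspan (s x ++ s y) (slice f (coact n)).
  move=> sub; rewrite /slice /tlift big_seq.
  elim/big_ind: _ => // [u v lu lv|p pn]; first by rewrite -[u]scale1r; apply: lD.
  apply: (subsp_scale _ (lspan_subspace _)).
  apply: lspan_mem; apply: sub; exact: map_f.
apply: (subsp_add (lspan_subspace _)); apply: lsl => u us;
  by rewrite mem_cat us ?orbT.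
Qed.

End Generated.

(** * Rank one maps, the regular comodule and matrix coefficients *)

Section RegularComodule.
Variables (k : fieldType) (H : hopfAlgebra k).

Definition reg_comod : comod H := @Comod k H H comul (@comulA k H) (@counitR k H).

Lemma rhoT_linr (T : twist H) (W V : comod H) (f : lhom W V) : lin (rhoT T f).
Proof. by have b := tw_bilin T; rewrite /rhoT; lint. Qed.

(** For a dual basis (e_i, xi_i) of [W], the required tensor is the sum of xi_i(-) v ⊗ h, with v ⊗ h
    running over [rhoT T f] at e_i. *)
Lemma fdim_homT (T : twist H) (W V : comod H) (f : lhom W V) :
  fdim W -> f \in @homT_pred _ _ T W V.
Proof.
move=> [s sE]; apply/asboolP.
have bl (p : lhom W k^o) :
    bilin (fun (v : V) (h : H) => rank1 p v ⊗ h).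
  by have l := @rank1_lin _ W V p; lint.
pose ev w := fun t : lhom W V ⨂ H => \sw_(g, h <- t) (lhom_fun g w ⊗ h).
have lev w : lin (ev w) by rewrite /ev; lint.
exists (\sum_(p <- s) \sw_(v, h <- rhoT T f p.1) (rank1 p.2 v ⊗ h)) => w.
rewrite -/(ev w _) (lin_suml _ _ (lev w)) [in RHS](sE w) (lin_suml _ _ (rhoT_linr T f)).
apply: eq_bigr => p _; rewrite (lin_sw _ _ (lev w)) (lin_scale _ _ (rhoT_linr T f)).
rewrite -[in RHS](sw_id (rhoT T f p.1)) scale_sw; apply: eq_sw => v h.
by rewrite /ev tlift_pure ?tpureZl //; lint.
Qed.

Section MatrixCoefficient.
Variables (W : comod H) (xi : lhom W k^o).
Definition mcoef_fun (w : W) : reg_comod := \sw_(w0, w1 <- coact w) ((xi w0 : k) *: w1).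
Lemma mcoef_lin : lin mcoef_fun.
Proof. by rewrite /mcoef_fun; lint. Qed.
Lemma mcoef_colin w :
  coact (mcoef_fun w) = \sw_(w0, w1 <- coact w) (mcoef_fun w0 ⊗ w1).
Proof.
transitivity (\sw_(w0, w1 <- coact w) \sw_(x, y <- coact w0)
   (((xi x : k) *: (y : reg_comod)) ⊗ w1)); last first.
  apply: eq_sw => w0 w1; rewrite /mcoef_fun -(lin_sw _ _ ((tpure_bilin _ _).1 w1)) //.
rewrite (coactE (T := fun x y w1 => ((xi x : k) *: (y : reg_comod)) ⊗ w1));
  last by split=> ? ?; lint.
rewrite (lin_sw _ _ (linE coact)); apply: eq_sw => w0 w1.
rewrite (lin_scale _ _ (linE coact)) -[X in _ *: X]sw_id scale_sw.
by apply: eq_sw => a b; rewrite tpureZl.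
Qed.
Definition mcoef : chom W reg_comod := mkCHom mcoef_lin mcoef_colin.
(** [H] is cofree on [k]: every functional is the counit after a comodule map, which puts rank one
    maps in the form that [ctau_eps] accepts. *)
Lemma counit_mcoef w : counit (mcoef w : H) = xi w.
Proof.
rewrite /= /mcoef_fun (lin_sw _ _ (linE counit)) -[RHS](coact_counitE (f := xi));
  last by lint.
by apply: eq_sw => a b; rewrite linearZ /= [LHS]mulrC.
Qed.
End MatrixCoefficient.

Definition reg_unit_fun (a : k^o) : reg_comod := (a : k) *: (1 : H).
Lemma reg_unit_lin : lin reg_unit_fun.
Proof. by rewrite /reg_unit_fun; lint. Qed.
Lemma reg_unit_colin (a : unit_comod H) :
  coact (reg_unit_fun a) = \sw_(w0, w1 <- coact a) (reg_unit_fun w0 ⊗ w1).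
Proof.
have l := reg_unit_lin.
rewrite [coact a]/(a ⊗ 1) tlift_pure; last by lint.
by rewrite /reg_unit_fun linearZ /= comul1 tpureZl.
Qed.
Definition reg_unit : chom (unit_comod H) reg_comod :=
  @mkCHom _ _ (unit_comod H) _ _ reg_unit_lin reg_unit_colin.

End RegularComodule.

(** * The action extracted from a central structure, and tau recovered from it *)

Section CenterAction.
Variables (k : fieldType) (H : hopfAlgebra k) (bijS : bijective (@antipode k H)).

Definition ctau (M : center bijS) (W : comod H) (f : homT (twl H) W M) (w : W) : M :=
  (center_tau M W f : homT (twr bijS) W M) w.

Section Object.
Variable M : center bijS.

Lemma ctau_lin W w : lin (fun f : homT (twl H) W M => ctau f w).
Proof.
rewrite /ctau => a f g.
by rewrite (lhomP (center_tau M W) a f g).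
Qed.
Lemma ctau_linr W (f : homT (twl H) W M) : lin (ctau f).
Proof. exact: lhomP. Qed.

Lemma ctau_nat W W' (c : chom W W') (f : homT (twl H) W M) (g : homT (twl H) W' M) w :
  (forall x, f x = g (c x)) -> ctau f w = ctau g (c w).
Proof.
move=> e; have -> : f = homT_pre (twl H) M c g by apply: homT_eq => x; rewrite e.
exact: (congr1 (fun h : chom (hom_l W' M) (hom_r bijS W M) =>
  (h g : homT (twr bijS) W M) w) (center_nat M c)).
Qed.

Definition eps_hom (W : comod H) (fdW : fdim W) (c : chom W (reg_comod H)) (m : M) :
  homT (twl H) W M :=
  HomT (fdim_homT (twl H) (rank1 (mkLHom (lin_comph (linE counit) (lhomP c))) m) fdW).

Definition center_act (h : H) (m : M) : M :=
  ctau (eps_hom (gen_fdim (h : reg_comod H) h) (sub_incl _) m) (genL _ _).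

(** Naturality is used along two maps out of the subcomodule generated by [w]: its inclusion into
    [W], and the restriction of [c] to the subcomodule generated by [c w], where the action is
    defined. [W] may be infinite dimensional. *)
Lemma ctau_eps W (c : chom W (reg_comod H)) m (f : homT (twl H) W M) w :
  (forall x, f x = (counit (c x : H) : k) *: m) -> ctau f w = center_act (c w) m.
Proof.
move=> fE.
pose i := sub_incl (@gen_stable _ _ W w w).
(* Comodule maps commute with slices of the coaction. *)
have ciP u : (chom_comp c i) u \in gen_pred (c w) (c w).
  have /asboolP [phi [psi eu]] := sub_valP u; apply/asboolP; exists phi, psi.
  have sc (p : lhom H k^o) n : c (slice p (coact n)) = slice p (coact (c n)).
    rewrite chom_colin (lin_sw _ _ (slice_lin (lhomP p))) [in LHS]/slice.
    rewrite (lin_sw _ _ (lhomP c)); apply: eq_sw => a b.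
    by rewrite slice_pure ?(lin_scale _ _ (lhomP c)) //; exact: lhomP.
  by rewrite /= eu (lin_add _ _ (lhomP c)) !sc.
pose c' := corestr (@gen_stable _ _ (reg_comod H) (c w) (c w)) ciP.
transitivity (ctau (homT_pre (twl H) M i f : homT (twl H) _ M) (genL w w)).
  exact/esym/(@ctau_nat _ _ i (homT_pre (twl H) M i f) f (genL w w)).
have -> : center_act (c w) m = ctau
    (eps_hom (gen_fdim (c w) (c w)) (sub_incl _) m) (c' (genL w w)).
  by rewrite /center_act; congr (ctau _ _); apply: sub_val_inj.
by apply: ctau_nat => u; rewrite /= fE.
Qed.

(** In [H]: [g], [h] and [a *: g + h] lie in one comodule [gen_comod g h], where the single linear
    map [ctau f] gives their actions. In [M]: tau is linear in [f]. *)
Lemma center_act_bilin : bilin center_act.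
Proof.
split=> [m a g h|h a m n].
  pose f := eps_hom (gen_fdim (g : reg_comod H) h) (sub_incl _) m.
  pose i := sub_incl (@gen_stable _ _ (reg_comod H) g h).
  have E u : center_act (i u) m = ctau f u by apply/esym/ctau_eps.
  have := E (a *: genL (g : reg_comod H) h + genR (g : reg_comod H) h).
  by rewrite ctau_linr -!E linearP.
rewrite /center_act -ctau_lin; congr (ctau _ _); apply: homT_eq => u.
by rewrite /= scalerDr scalerA mulrC -scalerA.
Qed.

(** A dual basis splits [f] into rank one maps, each evaluated by [ctau_eps] along a matrix
    coefficient. *)
Lemma ctau_fdim (W : comod H) (fdW : fdim W) (f : homT (twl H) W M) w :
  ctau f w = \sw_(w0, w1 <- coact w) center_act w1 (f w0).
Proof.
have ba := center_act_bilin.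
have [s sE] := fdW.
pose F (p : W * lhom W k^o) : homT (twl H) W M :=
  HomT (fdim_homT (twl H) (rank1 p.2 (f p.1)) fdW).
have fE : f = \sum_(p <- s) F p.
  apply: homT_eq => x; rewrite [in LHS](sE x) (lin_suml _ _ (lhomP f)).
  have lx : lin (fun g : homT (twl H) W M => g x) by lint.
  rewrite (lin_suml _ _ lx); apply: eq_bigr => p _.
  by rewrite (lin_scale _ _ (lhomP f)).
have l2 : lin (fun g : homT (twl H) W M => \sw_(w0, w1 <- coact w) center_act w1 (g w0)).
  by lint.
rewrite fE (lin_suml _ _ (ctau_lin w)) (lin_suml _ _ l2); apply: eq_bigr => p _.
rewrite (ctau_eps (c := mcoef p.2) (m := f p.1)); last first.
  by move=> x; rewrite counit_mcoef.
rewrite /= /mcoef_fun (lin_sw _ _ (ba.1 _)); apply: eq_sw => w0 w1.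
by rewrite (lin_scale _ _ (ba.1 _)) (lin_scale _ _ (ba.2 _)).
Qed.

(** Naturality restricts [f] to the finite dimensional subcomodule generated by [w]. *)
Lemma ctauE W (f : homT (twl H) W M) w :
  ctau f w = \sw_(w0, w1 <- coact w) center_act w1 (f w0).
Proof.
have ba := center_act_bilin.
pose i := sub_incl (@gen_stable _ _ W w w).
rewrite -(ctau_nat (c := i) (f := homT_pre (twl H) M i f) (genL w w)) //.
rewrite (ctau_fdim (gen_fdim w w)).
rewrite [coact w](chom_colin i (genL w w)) sw_sw; last by lint.
by apply: eq_sw => u h; rewrite tlift_pure //; lint.
Qed.

End Object.
End CenterAction.

(** * The aYD axioms for the extracted action *)

Section CenterToAYD.
Variables (k : fieldType) (H : hopfAlgebra k) (bijS : bijective (@antipode k H)).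
Local Notation "A ⊠ B" := (tens_comod A B) (at level 39, left associativity).
Local Notation S := (@antipode k H).

(** For inclusions into the regular comodule this trades the coaction of a subcomodule for
    [comul]. *)
Lemma chom_sw (X Y : comod H) (U : lmodType k) (c : chom X Y) (B : Y -> H -> U) x :
  bilin B -> \sw_(x0, x1 <- coact x) B (c x0) x1 = \sw_(y0, y1 <- coact (c x)) B y0 y1.
Proof.
move=> bB; rewrite chom_colin sw_sw //.
by apply: eq_sw => a b; rewrite tlift_pure.
Qed.

Section Object.
Variable M : center bijS.
Let ba := center_act_bilin M.

(** The unit map from [k] to [H] hits 1, so the action of 1 is computed by tau at the unit
    comodule. *)
Lemma center_act1 m : center_act 1 m = m :> M.
Proof.
pose f := eps_hom (M := M) (W := unit_comod H) (fdim_unit k) (reg_unit H) m.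
have := @ctau_eps _ _ _ _ _ (reg_unit H) m f (1 : k^o) (fun=> erefl).
rewrite /= /reg_unit_fun scale1r => <-.
rewrite [LHS]center_unit /= /reg_unit_fun scale1r counit1 scale1r //.
Qed.

(** Both sides evaluate tau of [f] at [w ⊗ v]: once by [ctauE] on [W ⊠ V], once through
    [center_tens]. *)
Lemma center_act_tens (W V : comod H) (f : homT (twl H) (W ⊠ V) M) w v :
  \sw_(w0, w1 <- coact w) \sw_(v0, v1 <- coact v) center_act (w1 * v1) (f (w0 ⊗ v0))
  = \sw_(w0, w1 <- coact w) \sw_(v0, v1 <- coact v)
      center_act w1 (center_act v1 (f (w0 ⊗ v0))).
Proof.
have b := ba.
transitivity (ctau f (w ⊗ v)).
  rewrite ctauE tens_comodE sw_sw; last by lint.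
  apply: eq_sw => w0 w1; rewrite sw_sw; last by lint.
  by apply: eq_sw => v0 v1; rewrite tlift_pure //; lint.
have := congr1 (fun h : chom (hom_l (W ⊠ V) M) (hom_r bijS V (hom_r bijS W M)) =>
  ((h f : homT (twr bijS) V (hom_r bijS W M)) v : homT (twr bijS) W M) w)
  (center_tens M W V).
rewrite [X in X = _ -> _](curry_rE (center_tau M (W ⊠ V) f)) => e.
rewrite [LHS]e [LHS]ctauE; apply: eq_sw => w0 w1.
rewrite [X in center_act _ X]exchE -(lin_sw _ _ (b.2 w1)); congr center_act.
rewrite [LHS](ctauE (M := M)); apply: eq_sw => v0 v1; congr center_act.
exact: curry_lE.
Qed.

(** [center_act_tens] is applied to the rank one map with functional eps ⊗ eps on the product of the
    subcomodules generated by [g] and [h]. *)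
Lemma center_actM g h m : center_act (g * h) m = center_act g (center_act h m) :> M.
Proof.
have b := ba.
pose X := gen_comod (g : reg_comod H) g; pose Y := gen_comod (h : reg_comod H) h.
pose i : chom X (reg_comod H) := sub_incl _; pose j : chom Y (reg_comod H) := sub_incl _.
have lxi : lin (fun t : X ⨂ Y => \sw_(x, y <- t) ((counit (i x : H) : k) *: counit (j y : H))).
  by lint.
pose f : homT (twl H) (X ⊠ Y) M := HomT (fdim_homT (W := X ⊠ Y) (twl H)
  (rank1 (mkLHom lxi) m) (fdim_tens (gen_fdim _ _) (gen_fdim _ _))).
have fE x y : f (x ⊗ y) = ((counit (i x : H) : k) * counit (j y : H)) *: m.
  by congr (_ *: _); rewrite [LHS]tlift_pure //; lint.
(* The two counits absorb the first legs of [g] and [h]. *)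
have collapse (B : H -> H -> M) : bilin B ->
    \sw_(x0, x1 <- coact (genL _ _ : X)) \sw_(y0, y1 <- coact (genL _ _ : Y))
      (((counit (i x0 : H) : k) * counit (j y0 : H)) *: B x1 y1) = B g h.
  move=> bB; rewrite -[RHS](counitLE (f := fun z => B z h)); last by lint.
  rewrite -(chom_sw i (B := fun z z' => (counit (z : H) : k) *: B z' h)
    (genL _ _)); last by lint.
  apply: eq_sw => x0 x1.
  rewrite -[X in _ *: X](counitLE (f := fun z => B x1 z)); last by lint.
  rewrite -(chom_sw j (B := fun z z' => (counit (z : H) : k) *: B x1 z')
    (genL _ _)); last by lint.
  by rewrite scale_sw; apply: eq_sw => y0 y1; rewrite scalerA.
have := center_act_tens f (genL _ _) (genL _ _).
under eq_sw => x0 x1 do under eq_sw => y0 y1 do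
  rewrite fE (lin_scale _ _ (b.2 _)).
rewrite (collapse (fun x y => center_act (x * y) m)); last by lint.
move=> ->; rewrite -(collapse (fun x y => center_act x (center_act y m))); last by lint.
apply: eq_sw => x0 x1; apply: eq_sw => y0 y1.
by rewrite fE !(lin_scale _ _ (b.2 _)).
Qed.

(** Colinearity of evaluation brings in the coaction of tau of [f]; colinearity of tau moves it to
    [f], where [rhoT] supplies the antipode. *)
Lemma ctau_coact (W : comod H) (f : homT (twl H) W M) w : coact (ctau f w) =
  \sw_(w0, w1 <- coact w) \sw_(x, y <- coact w0) \sw_(x0, x1 <- coact x)
    \sw_(v0, v1 <- coact (f x0)) (center_act y v0 ⊗ (w1 * v1 * S x1)).
Proof.
have b := ba.
have ll := @eval_r_lin _ _ bijS W M.
rewrite -[ctau f w]eval_r_pure (@eval_r_colin _ _ bijS W M (w ⊗ _)) tens_comodE.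
rewrite sw_sw; last by lint.
apply: eq_sw => w0 w1; rewrite sw_sw; last by lint.
rewrite chom_colin sw_sw; last by lint.
transitivity (\sw_(x, y <- coact w0) \sw_(v, h <- rhoT (twl H) f x)
    (center_act y v ⊗ (w1 * h))); last first.
  apply: eq_sw => x y; rewrite /rhoT sw_sw; last by lint.
  apply: eq_sw => x0 x1; rewrite sw_sw; last by lint.
  by apply: eq_sw => v0 v1; rewrite tlift_pure ?mulrA //; lint.
transitivity (\sw_(x, y <- coact w0) \sw_(f0, f1 <- @coact _ _ (hom_l W M) f)
    (center_act y ((f0 : homT (twl H) W M) x) ⊗ (w1 * f1))).
  rewrite sw_swap; apply: eq_sw => f0 f1.
  rewrite tlift_pure; last by lint.
  rewrite tlift_pure; last by lint.
  rewrite eval_r_pure [X in X ⊗ _](ctauE (f0 : homT (twl H) W M)).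
  by rewrite (lin_sw _ _ ((tpure_bilin _ _).1 _)).
apply: eq_sw => x y; rewrite -(@homT_comodE _ _ (twl H) W M) sw_sw; last by lint.
by apply: eq_sw => f0 f1; rewrite tlift_pure //; lint.
Qed.

(** This is [ctau_coact] for eps(-) m: the counit absorbs [x0], and [x1], [y], [w1] become [h1],
    [h2], [h3]. *)
Lemma center_act_coact h (m : M) : coact (center_act h m) =
  \sw_(x, h3 <- comul h) \sw_(h1, h2 <- comul x) \sw_(m0, m1 <- coact m)
      (center_act h2 m0 ⊗ (h3 * m1 * S h1)).
Proof.
have b := ba.
pose i := sub_incl (@gen_stable _ _ (reg_comod H) h h).
rewrite ctau_coact.
rewrite -[RHS](chom_sw i (B := fun (x : reg_comod H) h3 =>
  \sw_(h1, h2 <- comul (x : H)) \sw_(m0, m1 <- coact m)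
      (center_act h2 m0 ⊗ (h3 * m1 * S h1))) (genL _ _)); last by lint.
apply: eq_sw => w0 w1.
rewrite -[RHS](chom_sw i (B := fun (h1 : reg_comod H) h2 =>
  \sw_(m0, m1 <- coact m) (center_act h2 m0 ⊗ (w1 * m1 * S (h1 : H)))) w0); last by lint.
apply: eq_sw => x y.
(* A further coproduct of [h1] is inserted to match the third coaction on the left. *)
rewrite -[RHS](counitLE (f := fun z =>
  \sw_(m0, m1 <- coact m) (center_act y m0 ⊗ (w1 * m1 * S z)))); last by lint.
rewrite -[RHS](chom_sw i (B := fun (z : reg_comod H) z' =>
  (counit (z : H) : k) *: \sw_(m0, m1 <- coact m)
     (center_act y m0 ⊗ (w1 * m1 * S z'))) x); last by lint.
apply: eq_sw => x0 x1.
rewrite /= (lin_scale _ _ (linE coact)) (lin_scale _ _ (tlift_lin _)) //; lint.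
Qed.

Definition center_aYD : aYD H :=
  AYD ba center_act1 center_actM center_act_coact.

End Object.

(** Composing eps(-) m with [f] gives eps(-) (f m). *)
Lemma center_hom_act (M N : center bijS) (f : center_hom M N) h m :
  f (center_act h m) = center_act h (f m).
Proof.
set g := eps_hom (M := M) (gen_fdim (h : reg_comod H) h) (sub_incl _) m.
have := congr1 (fun c : chom (hom_l _ M) (hom_r bijS _ N) =>
  (c g : homT (twr bijS) _ N) (genL _ _)) (center_hom_tau f (gen_comod (h : reg_comod H) h)).
move=> e; rewrite [LHS]e; congr ((center_tau N _ _ : homT (twr bijS) _ N) _).
apply: homT_eq => u; rewrite /= (lin_scale _ _ (lhomP f)) //.
Qed.
End CenterToAYD.

(** * The central structure on an aYD module *)

Section AYDToCenter.
Variables (k : fieldType) (H : hopfAlgebra k) (bijS : bijective (@antipode k H)).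
Local Notation "A ⊠ B" := (tens_comod A B) (at level 39, left associativity).
Local Notation S := (@antipode k H).
Local Notation S' := (antipodeV bijS).

(** The coaction of an internal Hom is known only through its values, so the integrand sees [f0]
    only as [f0 x]. *)
Lemma coact_rhoT (T : twist H) (W V : comod H) (U : lmodType k)
    (f : homT T W V) (B : V -> H -> H -> H -> U) w :
  (forall y z, bilin (fun v h => B v h y z)) ->
  \sw_(f0, f1 <- @coact _ _ (homT_comod T W V) f) \sw_(w0, w1 <- coact w)
    \sw_(x, y <- coact w0) B ((f0 : homT T W V) x) f1 y w1
  = \sw_(w0, w1 <- coact w) \sw_(x, y <- coact w0) \sw_(x0, x1 <- coact x)
      \sw_(v0, v1 <- coact (f x0)) B v0 (T v1 x1) y w1.
Proof.
move=> bB; rewrite sw_swap; apply: eq_sw => w0 w1.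
rewrite sw_swap; apply: eq_sw => x y.
transitivity (\sw_(v, h <- rhoT T f x) B v h y w1).
  rewrite -homT_comodE sw_sw //.
  by apply: eq_sw => f0 f1; rewrite tlift_pure.
rewrite /rhoT sw_sw //; apply: eq_sw => x0 x1.
by rewrite sw_sw //; apply: eq_sw => v0 v1; rewrite tlift_pure.
Qed.

(** Coassociativity is used twice, ending in the bracketing of [ayd_coact]. *)
Lemma coactE3 (M : comod H) (U : lmodType k) (T : M -> H -> H -> H -> U) m :
  (forall a, trilin (fun x y z => T x y z a)) -> (forall x y z, lin (T x y z)) ->
  \sw_(m0, m1 <- coact m) \sw_(x, y <- coact m0) \sw_(a, b <- coact x) T a b y m1
  = \sw_(m0, m1 <- coact m) \sw_(p, d <- comul m1) \sw_(b, c <- comul p) T m0 b c d.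
Proof.
move=> tT lT.
transitivity (\sw_(m0, m1 <- coact m) \sw_(x, y <- coact m0) \sw_(b, c <- comul y)
    T x b c m1).
  by apply: eq_sw => m0 m1; rewrite (coactE (T := fun x y z => T x y z m1)).
rewrite (coactE (T := fun x y z => \sw_(b, c <- comul y) T x b c z)) //.
have tT1 b c d : lin (fun a => T a b c d) by case: (tT d).
have tT2 a c d : lin (fun b => T a b c d) by case: (tT d).
have tT3 a b d : lin (fun c => T a b c d) by case: (tT d).
have lT' a b c : lin (fun d => T a b c d) by apply: lT.
split=> *; last by apply: lin_swP => ? ?.
- by apply: (lin_swP (B := fun x b c => T x b c _)) => ? ?.
- by apply: lin_swA; [split=> ? | apply: linE].
Qed.

Section Object.
Variable M : aYD H.
Let ba := ayd_act_bilin M.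

Section Braiding.
Variable W : comod H.

Definition braid_fun (t : W ⨂ hom_l W M) : M :=
  \sw_(w, f <- t) \sw_(w0, w1 <- coact w) ayd_act w1 ((f : homT (twl H) W M) w0).
Lemma braid_lin : lin braid_fun.
Proof. by have b := ba; rewrite /braid_fun; lint. Qed.
Lemma braid_pure w (f : hom_l W M) : braid_fun (w ⊗ f)
  = \sw_(w0, w1 <- coact w) ayd_act w1 ((f : homT (twl H) W M) w0).
Proof. by have b := ba; rewrite /braid_fun tlift_pure //; lint. Qed.
(** Expanding the coaction of [f] gives w_2 . f(w_0)_0 ⊗ w_3 f(w_0)_1 S(w_1), the right side of the
    aYD condition. *)
Lemma braid_colin (t : W ⊠ hom_l W M) :
  coact (braid_fun t) = \sw_(m0, m1 <- coact t) (braid_fun m0 ⊗ m1).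
Proof.
have b := ba; have ll := braid_lin.
move: t; apply: chom_tens_ext => // w f; rewrite braid_pure.
transitivity (\sw_(f0, f1 <- coact f) \sw_(w0, w1 <- coact w) \sw_(x, y <- coact w0)
    (ayd_act y ((f0 : homT (twl H) W M) x) ⊗ (w1 * f1))); last first.
  rewrite sw_swap; apply: eq_sw => w0 w1; apply: eq_sw => f0 f1.
  by rewrite braid_pure (lin_sw _ _ ((tpure_bilin _ _).1 _)).
rewrite (@coact_rhoT _ _ _ _ f (fun v h y z => ayd_act y v ⊗ (z * h))); last by move=> *; lint.
rewrite (coactE3 (T := fun x0 x1 y w1 => \sw_(v0, v1 <- coact ((f : homT (twl H) W M) x0))
  (ayd_act y v0 ⊗ (w1 * twl H v1 x1)))).
- rewrite (lin_sw _ _ (linE coact)); apply: eq_sw => w0 w1.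
  rewrite ayd_coact; apply: eq_sw => p d; apply: eq_sw => x y; apply: eq_sw => v0 v1.
  by rewrite /= /twl_fun mulrA.
- by move=> ?; split=> ? ?; rewrite /= /twl_fun; lint.
- by move=> *; lint.
Qed.

Definition ayd_tau : chom (hom_l W M) (hom_r bijS W M) :=
  adj_r bijS (@mkCHom _ _ (W ⊠ hom_l W M) M _ braid_lin braid_colin).
Lemma ayd_tauE (f : homT (twl H) W M) w : (ayd_tau f : homT (twr bijS) W M) w
  = \sw_(w0, w1 <- coact w) ayd_act w1 (f w0).
Proof. exact: braid_pure. Qed.

Definition braidV_fun (t : hom_r bijS W M ⨂ W) : M :=
  \sw_(f, w <- t) \sw_(w0, w1 <- coact w)
    ayd_act (S' w1) ((f : homT (twr bijS) W M) w0).
Lemma braidV_lin : lin braidV_fun.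
Proof. by have b := ba; have l := antipodeV_lin bijS; rewrite /braidV_fun; lint. Qed.
Lemma braidV_pure (f : hom_r bijS W M) w : braidV_fun (f ⊗ w)
  = \sw_(w0, w1 <- coact w) ayd_act (S' w1) ((f : homT (twr bijS) W M) w0).
Proof.
by have b := ba; have l := antipodeV_lin bijS; rewrite /braidV_fun tlift_pure //; lint.
Qed.
(** The aYD condition is applied to S^-1(w_1). As S^-1 reverses the coproduct, [S] cancels on the
    last leg, leaving S^-1(w_1) f(w_0)_1 w_3, whose first two factors form [twr]. *)
Lemma braidV_colin (t : hom_r bijS W M ⊠ W) :
  coact (braidV_fun t) = \sw_(m0, m1 <- coact t) (braidV_fun m0 ⊗ m1).
Proof.
have b := ba; have ll := braidV_lin; have lS := antipodeV_lin bijS.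
move: t; apply: chom_tens_ext => // f w; rewrite braidV_pure.
transitivity (\sw_(f0, f1 <- coact f) \sw_(w0, w1 <- coact w) \sw_(x, y <- coact w0)
    (ayd_act (S' y) ((f0 : homT (twr bijS) W M) x) ⊗ (f1 * w1))); last first.
  apply: eq_sw => f0 f1; apply: eq_sw => w0 w1.
  by rewrite braidV_pure (lin_sw _ _ ((tpure_bilin _ _).1 _)).
rewrite (@coact_rhoT _ _ _ _ f (fun v h y z => ayd_act (S' y) v ⊗ (h * z))); last by move=> *; lint.
rewrite (coactE3 (T := fun x0 x1 y w1 =>
  \sw_(v0, v1 <- coact ((f : homT (twr bijS) W M) x0))
    (ayd_act (S' y) v0 ⊗ (twr bijS v1 x1 * w1)))); last first.
- by move=> *; lint.
- by move=> ?; split=> ? ?; rewrite /= /twr_fun; lint.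
rewrite (lin_sw _ _ (linE coact)); apply: eq_sw => w0 w1.
rewrite (comulE (T := fun x1 y z => \sw_(v0, v1 <- coact ((f : homT (twr bijS) W M) w0))
    (ayd_act (S' y) v0 ⊗ (twr bijS v1 x1 * z)))); last first.
  by split=> ? ?; rewrite /= /twr_fun; lint.
rewrite ayd_coact antipodeV_comul sw_sw; last by lint.
apply: eq_sw => p q; rewrite tlift_pure; last by lint.
rewrite antipodeV_comul sw_sw; last by lint.
apply: eq_sw => c d; rewrite tlift_pure; last by lint.
by apply: eq_sw => v0 v1; rewrite antipodeVK.
Qed.

Definition ayd_tauV : chom (hom_r bijS W M) (hom_l W M) :=
  adj_l (@mkCHom _ _ (hom_r bijS W M ⊠ W) M _ braidV_lin braidV_colin).
Lemma ayd_tauVE (f : homT (twr bijS) W M) w : (ayd_tauV f : homT (twl H) W M) w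
  = \sw_(w0, w1 <- coact w) ayd_act (S' w1) (f w0).
Proof. exact: braidV_pure. Qed.

(** The composites collapse by S^-1(h_2) h_1 = eps(h) 1 and h_2 S^-1(h_1) = eps(h) 1. *)
Lemma ayd_tau_iso : chom_iso ayd_tau.
Proof.
have b := ba; have lS := antipodeV_lin bijS.
exists ayd_tauV; split; apply: chom_eq => f; apply: homT_eq => w.
- rewrite [LHS]ayd_tauVE; under eq_sw => w0 w1 do
    rewrite ayd_tauE (lin_sw _ _ (b.2 _)).
  under eq_sw => w0 w1 do under eq_sw => x y do rewrite -ayd_actM.
  rewrite (coactE (T := fun x y z => ayd_act (S' z * y) ((f : homT (twl H) W M) x)));
    last by split=> ? ?; lint.
  rewrite -[RHS](coact_counitE (f := (f : homT (twl H) W M))); last by lint.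
  apply: eq_sw => w0 w1.
  rewrite -(lin_sw (fun y z => S' z * y) _ (b.1 _)) antipodeVL.
  by rewrite (lin_scale _ _ (b.1 _)) ayd_act1.
- rewrite [LHS]ayd_tauE; under eq_sw => w0 w1 do
    rewrite ayd_tauVE (lin_sw _ _ (b.2 _)).
  under eq_sw => w0 w1 do under eq_sw => x y do rewrite -ayd_actM.
  rewrite (coactE (T := fun x y z => ayd_act (z * S' y) ((f : homT (twr bijS) W M) x)));
    last by split=> ? ?; lint.
  rewrite -[RHS](coact_counitE (f := (f : homT (twr bijS) W M))); last by lint.
  apply: eq_sw => w0 w1.
  rewrite -(lin_sw (fun y z => z * S' y) _ (b.1 _)) antipodeVR.
  by rewrite (lin_scale _ _ (b.1 _)) ayd_act1.
Qed.
End Braiding.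

Lemma ayd_tau_nat (W W' : comod H) (c : chom W W') :
  chom_comp (ayd_tau W) (homT_pre (twl H) M c)
  = chom_comp (homT_pre (twr bijS) M c) (ayd_tau W').
Proof.
have b := ba; apply: chom_eq => f; apply: homT_eq => w.
rewrite [LHS]ayd_tauE [RHS]ayd_tauE.
by rewrite -(chom_sw c (B := fun w0 w1 => ayd_act w1 ((f : homT (twl H) W' M) w0))) //; lint.
Qed.

Lemma ayd_tau_unit (f : homT (twl H) (unit_comod H) M) :
  (ayd_tau (unit_comod H) f : homT (twr bijS) _ _) 1 = f 1.
Proof.
have b := ba; rewrite [LHS]ayd_tauE tlift_pure; last by lint.
exact: ayd_act1.
Qed.

(** The coaction of [W ⊠ V] multiplies legs as [w1 * v1], and [ayd_actM] splits this product. *)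
Lemma ayd_tau_tens (W V : comod H) :
  chom_comp (curry_r bijS W V M) (ayd_tau (W ⊠ V))
  = chom_comp (homT_post (twr bijS) V (ayd_tau W))
      (chom_comp (exch bijS W V M)
         (chom_comp (homT_post (twl H) W (ayd_tau V)) (curry_l W V M))).
Proof.
have b := ba; apply: chom_eq => f; apply: homT_eq => v; apply: homT_eq => w.
rewrite [LHS]curry_rE [LHS]ayd_tauE tens_comodE sw_sw; last by lint.
rewrite [RHS]ayd_tauE; apply: eq_sw => w0 w1; rewrite sw_sw; last by lint.
rewrite [X in ayd_act _ X]exchE [X in ayd_act _ X]ayd_tauE (lin_sw _ _ (b.2 _)).
apply: eq_sw => v0 v1; rewrite tlift_pure; last by lint.
by rewrite ayd_actM [X in _ = ayd_act _ (ayd_act _ X)]curry_lE.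
Qed.

Definition aYD_center : center bijS :=
  Center ayd_tau_iso ayd_tau_nat ayd_tau_unit ayd_tau_tens.

(** On eps(-) m the formula for tau gives eps(h_1) h_2 . m. *)
Lemma aYD_center_act h m : @center_act _ _ bijS aYD_center h m = ayd_act h m.
Proof.
have b := ba; rewrite [LHS]ayd_tauE.
pose i := sub_incl (@gen_stable _ _ (reg_comod H) h h).
rewrite -[RHS](counitLE (f := fun z => ayd_act z m)); last by lint.
rewrite -(chom_sw i (B := fun (z : reg_comod H) z' => (counit (z : H) : k) *: ayd_act z' m)
  (genL _ _)); last by lint.
by apply: eq_sw => w0 w1; rewrite /= (lin_scale _ _ (b.2 _)).
Qed.

End Object.

Lemma aYD_hom_tau (M N : aYD H) (f : aYD_hom M N) (W : comod H) :
  chom_comp (homT_post (twr bijS) W f) (ayd_tau M W)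
  = chom_comp (ayd_tau N W) (homT_post (twl H) W f).
Proof.
apply: chom_eq => g; apply: homT_eq => w.
rewrite [LHS]homT_postE ayd_tauE (lin_sw _ _ (lhomP f)) [RHS]ayd_tauE.
by apply: eq_sw => w0 w1; rewrite ayd_hom_act.
Qed.
End AYDToCenter.

(** * The two functors and their round trips *)

Section Equivalence.
Variables (k : fieldType) (H : hopfAlgebra k) (bijS : bijective (@antipode k H)).

Definition aYD_center_map (M N : aYD H) (f : aYD_hom M N) :
    center_hom (aYD_center bijS M) (aYD_center bijS N) :=
  @CenterHom _ _ bijS (aYD_center bijS M) (aYD_center bijS N) f (aYD_hom_tau bijS f).

Lemma aYD_center_map_id M : aYD_center_map (aYD_id M) = center_id (aYD_center bijS M).
Proof. exact: center_hom_eq. Qed.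
Lemma aYD_center_map_comp M N P (g : aYD_hom N P) (f : aYD_hom M N) :
  aYD_center_map (aYD_comp g f) = center_comp (aYD_center_map g) (aYD_center_map f).
Proof. exact: center_hom_eq. Qed.

Definition aYD_to_center : functor (aYD_category H) (center_category bijS) :=
  @Functor (aYD_category H) (center_category bijS) _ _
    aYD_center_map_id aYD_center_map_comp.

Definition center_aYD_map (M N : center bijS) (f : center_hom M N) :
    aYD_hom (center_aYD M) (center_aYD N) :=
  @AYDHom _ _ (center_aYD M) (center_aYD N) f (center_hom_act f).

Lemma center_aYD_map_id M : center_aYD_map (center_id M) = aYD_id (center_aYD M).
Proof. exact: aYD_hom_eq. Qed.
Lemma center_aYD_map_comp M N P (g : center_hom N P) (f : center_hom M N) :
  center_aYD_map (center_comp g f) = aYD_comp (center_aYD_map g) (center_aYD_map f).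
Proof. exact: aYD_hom_eq. Qed.

Definition center_to_aYD : functor (center_category bijS) (aYD_category H) :=
  @Functor (center_category bijS) (aYD_category H) _ _
    center_aYD_map_id center_aYD_map_comp.

(** By [ctauE] a central structure is determined by its action. *)
Lemma center_aYD_tau (M : center bijS) (W : comod H) f :
  ayd_tau bijS (center_aYD M) W f = center_tau M W f.
Proof.
apply: homT_eq => w; rewrite [LHS]ayd_tauE; exact/esym/(ctauE (M := M)).
Qed.

End Equivalence.

Theorem proposition2p7 (k : fieldType) (char0 : [pchar k] =i pred0)
    (H : hopfAlgebra k) (bijS : bijective (@antipode k H)) :
  equivalent (aYD_category H) (center_category bijS).
Proof.
exists (aYD_to_center bijS), (center_to_aYD bijS); split.
(* The comodule is unchanged and the actions agree pointwise, so its identity map is [H]-linear both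
   ways. *)
- pose eta (M : aYD H) : aYD_hom (center_aYD (aYD_center bijS M)) M :=
    @AYDHom _ _ (center_aYD (aYD_center bijS M)) M (chom_id M)
      (@aYD_center_act _ _ bijS M).
  pose eta' (M : aYD H) : aYD_hom M (center_aYD (aYD_center bijS M)) :=
    @AYDHom _ _ M (center_aYD (aYD_center bijS M)) (chom_id M)
      (fun h m => esym (@aYD_center_act _ _ bijS M h m)).
  exists eta; split=> [M|M N f]; last exact: aYD_hom_eq.
  by exists (eta' M); split; apply: aYD_hom_eq.
- have post_id T (M W : comod H) : homT_post T W (chom_id M) = chom_id _.
    by apply: chom_eq => f; apply: homT_eq.
  (* Since tau is recovered, the identity comodule map commutes with it in both directions. *)
  have h1 (M : center bijS) W :
      chom_comp (homT_post (twr bijS) W (chom_id M))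
        (center_tau (aYD_center bijS (center_aYD M)) W)
      = chom_comp (center_tau M W) (homT_post (twl H) W (chom_id M)).
    by rewrite !post_id; apply: chom_eq => f; apply: center_aYD_tau.
  have h2 (M : center bijS) W :
      chom_comp (homT_post (twr bijS) W (chom_id M)) (center_tau M W)
      = chom_comp (center_tau (aYD_center bijS (center_aYD M)) W)
          (homT_post (twl H) W (chom_id M)).
    by rewrite !post_id; apply: chom_eq => f; apply/esym/center_aYD_tau.
  pose eta (M : center bijS) : center_hom (aYD_center bijS (center_aYD M)) M :=
    @CenterHom _ _ _ (aYD_center bijS (center_aYD M)) M (chom_id M) (h1 M).
  pose eta' (M : center bijS) : center_hom M (aYD_center bijS (center_aYD M)) :=
    @CenterHom _ _ _ M (aYD_center bijS (center_aYD M)) (chom_id M) (h2 M).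
  exists eta; split=> [M|M N f]; last exact: center_hom_eq.
  by exists (eta' M); split; apply: center_hom_eq.
Qed.
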